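(* Let $(X,\mu,d)$ be a Calderón--Zygmund space, with family $\mathcal R$ of Calderón--Zygmund sets, which satisfies condition (C). Let $T$ be a linear operator which is bounded on $L^2(\mu)$ and admits a locally integrable kernel $K$ off the diagonal that satisfies $$\sup_{R\in\mathcal R}\ \sup_{y,z\in R}\int_{(R^* )^c}|K(x,y)-K(x,z)|\,d\mu(x)<\infty .$$ Then $T$ is bounded from $H^{1,q}$ to $L^1(\mu)$, for all $1<q\le2$.
   Context: **Calderón--Zygmund spaces.** Let $(X,\mu,d)$ be a metric measured space, $\mathcal R$ a family of (measurable) subsets of $X$ and $\kappa_0>0$. $(X,\mu,d)$ is a Calderón--Zygmund space with constant $\kappa_0$ (and family $\mathcal R$ of Calderón--Zygmund sets) if: (i) for every $R\in\mathcal R$ there exists $r>0$ such that $R$ is contained in a ball of radius at most $\kappa_0r$ and $\mu(R^* )\le\kappa_0\,\mu(R)$, where $R^*=\{x\in X:d(x,R)<r\}$ (this $r$ and $R^*$ are fixed for each $R$); (ii) for every $f\in L^1(\mu)$ and $\alpha>\kappa_0\|f\|_{L^1(\mu)}/\mu(X)$ ($\alpha>0$ if $\mu(X)=\infty$) there is a decomposition $f=g+\sum_{i\in\mathbb N}b_i$ such that: $|g|\le\kappa_0\alpha$ $\mu$-a.e.; each $b_i$ is supported in a set $R_i\in\mathcal R$ and $\int b_i\,d\mu=0$; $\|b_i\|_{L^1(\mu)}\le\kappa_0\,\alpha\,\mu(R_i)$; $\sum_i\mu(R_i)\le\kappa_0\|f\|_{L^1(\mu)}/\alpha$. **Condition (C).**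 There exists a subfamily $\mathcal R'\subseteq\mathcal R$ such that: (i) if $R_1,R_2\in\mathcal R'$ and $R_1\cap R_2\ne\emptyset$, then $R_1\subseteq R_2$ or $R_2\subseteq R_1$; (ii) every $R\in\mathcal R$ is contained in some $R'\in\mathcal R'$. **Kernel.** That $K$ is a kernel of $T$ off the diagonal means that $Tf(x)=\int K(x,y)f(y)\,d\mu(y)$ for a.e. $x$ outside the support of $f$ (for, say, $f\in L^2(\mu)$ with bounded support). By a theorem of Hebisch and Steger (which may be used as known), if $(X,\mu,d)$ is a Calderón--Zygmund space with family $\mathcal R$ of Calderón--Zygmund sets, and $T$ is a linear operator which is bounded on $L^2(\mu)$ and admits a locally integrable kernel $K$ off the diagonal satisfying $\sup_{R\in\mathcal R}\sup_{y,z\in R}\int_{(R^* )^c}|K(x,y)-K(x,z)|\,d\mu(x)<\infty$, then $T$ extends from $L^1(\mu)\cap L^2(\mu)$ to a bounded operator from $L^1(\mu)$ to $L^{1,\infty}(\mu)$ and on $L^p(\mu)$, $1<p\le2$; the extension is still denoted $T$. **Hardy spaces.** For $1<q<\infty$, a $(1,q)$-atom is a function $a\in L^1(\mu)$ supported in a Calderón--Zygmund set $R\in\mathcal R$ with $\big(\frac1{\mu(R)}\int_R|a|^q\,d\mu\big)^{1/q}\le\mu(R)^{-1}$ and $\int a\,d\mu=0$. $H^{1,q}$ is the space of all $f\in L^1(\mu)$ of the form $f=\sum_j\lambda_ja_j$, with $a_j$ $(1,q)$-atoms and $\lambda_j\in\mathbb C$, $\sum_j|\lambda_j|<\infty$;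 $\|f\|_{H^{1,q}}$ is the infimum of $\sum_j|\lambda_j|$ over all such decompositions. *)

(* Defs.v *)
From HB Require Import structures.
From mathcomp Require Import all_boot all_order all_algebra.
From mathcomp Require Import complex.
From mathcomp Require Import all_classical all_reals all_analysis.

Set Implicit Arguments.
Unset Strict Implicit.
Unset Printing Implicit Defensive.

Import Order.TTheory GRing.Theory Num.Theory.
Import numFieldNormedType.Exports.
Import Normc.

Local Open Scope classical_set_scope.
Local Open Scope ring_scope.
Local Open Scope complex_scope.
Local Open Scope ereal_scope.

#[short(type="metricMeasurableType")]
HB.structure Definition MetricMeasurable (K : numDomainType)
  (d : measure_display) := { X of Metric K X & Measurable d X }.

(* The sigma-algebra contains the Borel sets; it may be larger (completion). *)
Definition borel_compatible (R : realType) (d : measure_display)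
    (X : metricMeasurableType R d) : Prop :=
  forall U : set X, open U -> measurable U.

Section ComplexFunctions.
Context (R : realType) (d : measure_display) (X : measurableType d).
Variable mu : {measure set X -> \bar R}.
Implicit Types (f g : X -> R[i]) (D : set X) (p : R).

Definition cmeasurable f : Prop :=
  measurable_fun setT (fun x => complex.Re (f x)) /\
  measurable_fun setT (fun x => complex.Im (f x)).

Definition cLnorm p f : \bar R :=
  Lnorm mu p%:E (fun x => (normc (f x))%:E).

(* Functions, not classes: everything below is stated up to mu-null sets. *)
Definition cL p : set (X -> R[i]) :=
  [set f | cmeasurable f /\ cLnorm p f < +oo].

Definition cint D f : R[i] :=
  Rintegral mu D (fun x => complex.Re (f x)) +i*
  Rintegral mu D (fun x => complex.Im (f x)).

Definition weakL1norm f : \bar R :=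
  ereal_sup [set t%:E * mu [set x | (t < normc (f x))%R] | t in `]0%R, +oo[].

Definition supported_in f D : Prop := {ae mu, forall x, ~ D x -> f x = 0%R}.

(* Convergence of the series in L^1; under the summability conditions imposed
   wherever this is used it is absolute, hence also holds almost everywhere. *)
Definition L1_sum (b : nat -> X -> R[i]) f : Prop :=
  (fun n => cLnorm 1 (fun x => (f x - \sum_(i < n) b i x)%R)) @ \oo --> 0.

Definition ae_linear_on (D : set (X -> R[i]))
    (T : (X -> R[i]) -> (X -> R[i])) : Prop :=
  forall (a : R[i]) f g, D f -> D g ->
    {ae mu, forall x, T (fun y => (a * f y + g y)%R) x = (a * T f x + T g x)%R}.

Definition L2_bounded_operator (T : (X -> R[i]) -> (X -> R[i])) : Prop :=
  ae_linear_on (cL 2) T /\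
  exists C : R, forall f, cL 2 f ->
    cL 2 (T f) /\ cLnorm 2 (T f) <= C%:E * cLnorm 2 f.

(* These conditions determine T1 f up to null sets for every f in L^1, as
   L^1 /\ L^2 is dense in L^1. *)
Definition L1_extension (T T1 : (X -> R[i]) -> (X -> R[i])) : Prop :=
  [/\ ae_linear_on (cL 1) T1,
      (forall f, cL 1 f -> cL 2 f -> {ae mu, forall x, T1 f x = T f x}) &
      exists C : R, forall f, cL 1 f ->
        cmeasurable (T1 f) /\ weakL1norm (T1 f) <= C%:E * cLnorm 1 f].

End ComplexFunctions.

Section CalderonZygmund.
Context (R : realType) (d : measure_display) (X : metricMeasurableType R d).
Variable mu : {sigma_finite_measure set X -> \bar R}.
Implicit Types (A : set X) (f g : X -> R[i]) (calR : set (set X)).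

(* The distance to the empty set is +oo. *)
Definition set_dist (x : X) A : \bar R :=
  ereal_inf [set (mdist x y)%:E | y in A].

Definition star (rad : set X -> R) A : set X :=
  [set x | set_dist x A < (rad A)%:E].

(* rad chooses the radius r attached to each set of the family. In the lower
   bound on alpha, x / +oo = 0. *)
Definition CZ_space calR (kappa0 : R) (rad : set X -> R) : Prop :=
  [/\ (0 < kappa0)%R,
      (forall A, calR A -> measurable A),
      (forall A, calR A ->
        [/\ (0 < rad A)%R,
            (exists (c : X) (s : R),
               [/\ (0 < s)%R, (s <= kappa0 * rad A)%R & A `<=` ball c s]) &
            mu (star rad A) <= kappa0%:E * mu A]) &
      (forall f (alpha : R), cL mu 1 f ->
        kappa0%:E * cLnorm mu 1 f / mu setT < alpha%:E ->
        exists (g : X -> R[i]) (b : nat -> X -> R[i]) (B : nat -> set X),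
          [/\ cmeasurable g /\
                {ae mu, forall x, (normc (g x) <= kappa0 * alpha)%R},
              L1_sum mu b (fun x => (f x - g x)%R),
              (forall i, [/\ calR (B i), cL mu 1 (b i),
                 supported_in mu (b i) (B i), cint mu setT (b i) = 0%R &
                 cLnorm mu 1 (b i) <= kappa0%:E * alpha%:E * mu (B i)]) &
              \sum_(0 <= i <oo) mu (B i) <=
                kappa0%:E * cLnorm mu 1 f / alpha%:E])].

Definition condition_C calR : Prop :=
  exists calR' : set (set X),
    [/\ calR' `<=` calR,
        (forall A1 A2, calR' A1 -> calR' A2 -> A1 `&` A2 !=set0 ->
           A1 `<=` A2 \/ A2 `<=` A1) &
        (forall A, calR A -> exists2 A', calR' A' & A `<=` A')].

(* K is a function on the complement of the diagonal, extended measurably and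
   arbitrarily to the diagonal, where its values never matter: U and V can be
   shrunk to disjoint sets, and below K (x, y) only occurs with x <> y or
   multiplied by 0. *)
Definition locally_integrable_off_diagonal (K : X * X -> R[i]) : Prop :=
  cmeasurable K /\
  forall x y : X, x <> y -> exists U V : set X,
    [/\ open U /\ U x, open V /\ V y &
        \int[mu \x mu]_(z in U `*` V) (normc (K z))%:E < +oo].

Definition fsupport f : set X := closure [set x | f x <> 0%R].

Definition kernel_off_diagonal (T : (X -> R[i]) -> (X -> R[i]))
    (K : X * X -> R[i]) : Prop :=
  forall f, cL mu 2 f -> (exists (c : X) (s : R), fsupport f `<=` ball c s) ->
    {ae mu, forall x, ~ fsupport f x ->
       cL mu 1 (fun y => (K (x, y) * f y)%R) /\
       T f x = cint mu setT (fun y => (K (x, y) * f y)%R)}.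

Definition hormander_sup calR (rad : set X -> R) (K : X * X -> R[i]) : \bar R :=
  ereal_sup [set
    ereal_sup [set
      \int[mu]_(x in ~` star rad A) (normc (K (x, yz.1) - K (x, yz.2)))%:E
      | yz in A `*` A]
    | A in calR].

(* The condition mu A < +oo makes the averages over A meaningful. It is automatic
   when balls have finite measure. *)
Definition is_atom calR (q : R) (a : X -> R[i]) : Prop :=
  exists A : set X,
    [/\ calR A /\ mu A < +oo, cL mu 1 a, supported_in mu a A,
        ((mu A)^-1 * \int[mu]_(x in A) ((normc (a x)) `^ q)%:E) `^ q^-1
          <= (mu A)^-1 &
        cint mu setT a = 0%R].

Definition atomic_decomposition calR (q : R) f (lambda : nat -> R[i])
    (a : nat -> X -> R[i]) : Prop :=
  [/\ (forall j, is_atom calR q (a j)),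
      \sum_(0 <= j <oo) (normc (lambda j))%:E < +oo &
      L1_sum mu (fun j x => (lambda j * a j x)%R) f].

Definition H1 calR (q : R) : set (X -> R[i]) :=
  [set f | cL mu 1 f /\ exists lambda a, atomic_decomposition calR q f lambda a].

Definition H1norm calR (q : R) f : \bar R :=
  ereal_inf [set \sum_(0 <= j <oo) (normc (lambda j))%:E
    | lambda in [set lambda | exists a, atomic_decomposition calR q f lambda a]].

End CalderonZygmund.

(* Main.v *)
(**
  Write [S = star rad A] for an atom [a] living on [A].  Splitting [a] at height
  [t] and using the weak (1,1) bound for the large part and the L^2 bound for
  the small one gives [mu {|T1 a| > t} <= C t^(-q) int |a|^q], and summing over
  dyadic heights above [1 / mu A] bounds [int_S |T1 a|].  Off [S], the
  cancellation of [a] lets one replace [K (x, y)] by [K (x, y) - K (x, z)] with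
  [z] in [A], so Tonelli and the Hormander condition bound the integral; since
  the kernel formula is only available in L^2, this is done for truncated
  atoms, corrected to have mean zero.  Both this truncation and the passage
  from atoms to atomic sums use that a bound [int_D |T1 g| <= M] survives L^1
  limits in [g]: [T1] is continuous from L^1 into convergence in measure, and
  Borel-Cantelli with Fatou's lemma applies.
*)
Require Import Defs.
From HB Require Import structures.
From mathcomp Require Import all_boot all_order all_algebra.
From mathcomp Require Import complex.
From mathcomp Require Import all_classical all_reals all_analysis.
From mathcomp Require Import measurable_realfun ring lra.

Set Implicit Arguments.
Unset Strict Implicit.
Unset Printing Implicit Defensive.

Import Order.TTheory GRing.Theory Num.Theory.
Import numFieldNormedType.Exports.
Import Normc.

Local Open Scope classical_set_scope.
Local Open Scope ring_scope.
Local Open Scope complex_scope.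
Local Open Scope ereal_scope.

(** * Complex-valued functions *)

Section ComplexModulus.
Context {R : realType}.
Implicit Types z w : R[i].

Lemma normc_ge0 z : (0 <= normc z)%R.
Proof. by case: z => a b; exact: sqrtr_ge0. Qed.

Lemma normcD z w : (normc (z + w) <= normc z + normc w)%R.
Proof. exact: le_normcD. Qed.

Lemma normc_real (r : R) : normc r%:C = `|r|%R.
Proof. by rewrite /normc /= expr0n /= addr0 sqrtr_sqr. Qed.

Lemma normc_opp z : normc (- z)%R = normc z.
Proof. by case: z => a b; rewrite /normc /= !sqrrN. Qed.

Lemma Re_le_normc z : (`|complex.Re z| <= normc z)%R.
Proof.
case: z => a b /=; rewrite -sqrtr_sqr ler_wsqrtr// lerDl sqr_ge0//.
Qed.

Lemma Im_le_normc z : (`|complex.Im z| <= normc z)%R.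
Proof.
case: z => a b /=; rewrite -sqrtr_sqr ler_wsqrtr// lerDr sqr_ge0//.
Qed.

Lemma normc_le_ReIm z : (normc z <= `|complex.Re z| + `|complex.Im z|)%R.
Proof.
case: z => a b /=.
rewrite -[leRHS]ger0_norm ?addr_ge0// -sqrtr_sqr ler_wsqrtr//.
rewrite sqrrD !real_normK ?num_real// lerD2r lerDl.
by rewrite mulrn_wge0// mulr_ge0.
Qed.

End ComplexModulus.

(** * Measurability of complex-valued functions, by real and imaginary parts *)

Section ComplexMeasurable.
Context {R : realType} {d : measure_display} {X : measurableType d}.
Implicit Types f g : X -> R[i].

Lemma cmeasurable_normc f : cmeasurable f ->
  measurable_fun setT (fun x => normc (f x)).
Proof.
move=> [mr mi].
rewrite (_ : (fun x => _) = fun x => Num.sqrt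
  (complex.Re (f x) ^+ 2 + complex.Im (f x) ^+ 2)); last first.
  by apply/funext => x; case: (f x).
apply: (@measurableT_comp _ _ _ _ _ _ (@Num.sqrt R)).
  by apply: continuous_measurable_fun; exact: sqrt_continuous.
by apply: measurable_funD; exact: measurable_funX.
Qed.

Lemma cmeasurable_normcE D f : cmeasurable f ->
  measurable_fun D (fun x => (normc (f x))%:E).
Proof.
move=> mf; apply/measurable_EFinP.
apply: (measurable_funS measurableT) => //; exact: cmeasurable_normc.
Qed.

Lemma cmeasurableD f g : cmeasurable f -> cmeasurable g ->
  cmeasurable (fun x => (f x + g x)%R).
Proof.
move=> [fr fi] [gr gi]; split.
- rewrite (_ : (fun x => _) = fun x => complex.Re (f x) + complex.Re (g x))%R.
    exact: measurable_funD.
  by apply/funext => x; case: (f x) (g x) => ? ? [].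
- rewrite (_ : (fun x => _) = fun x => complex.Im (f x) + complex.Im (g x))%R.
    exact: measurable_funD.
  by apply/funext => x; case: (f x) (g x) => ? ? [].
Qed.

Lemma cmeasurableM f g : cmeasurable f -> cmeasurable g ->
  cmeasurable (fun x => (f x * g x)%R).
Proof.
move=> [fr fi] [gr gi]; split.
- rewrite (_ : (fun x => _) = fun x => complex.Re (f x) * complex.Re (g x)
     - complex.Im (f x) * complex.Im (g x))%R.
    by apply: measurable_funB; exact: measurable_funM.
  by apply/funext => x; case: (f x) (g x) => ? ? [].
- rewrite (_ : (fun x => _) = fun x => complex.Re (f x) * complex.Im (g x)
     + complex.Im (f x) * complex.Re (g x))%R.
    by apply: measurable_funD; exact: measurable_funM.
  by apply/funext => x; case: (f x) (g x) => ? ? [].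
Qed.

Lemma cmeasurable_cst (c : R[i]) : cmeasurable (fun _ : X => c).
Proof. by split; exact: measurable_cst. Qed.

Lemma cmeasurable_indic (A : set X) : measurable A ->
  cmeasurable (fun x => (\1_A x : R)%:C).
Proof. by move=> mA; split => /=; [exact: measurable_indic|]. Qed.

Lemma cmeasurableB f g : cmeasurable f -> cmeasurable g ->
  cmeasurable (fun x => (f x - g x)%R).
Proof.
move=> mf mg.
rewrite (_ : (fun x => _) = fun x => f x + (-1) * g x)%R; last first.
  by apply/funext => x; rewrite mulN1r.
by apply: cmeasurableD => //; apply: cmeasurableM => //; exact: cmeasurable_cst.
Qed.

Lemma measurable_normc_gt f t : cmeasurable f ->
  measurable [set x | (t < normc (f x))%R].
Proof.
move=> mf; rewrite -[X in measurable X]setTI.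
rewrite (_ : [set x | _] = [set x | t%:E < (normc (f x))%:E]).
  by apply: emeasurable_fun_o_infty => //; exact: cmeasurable_normcE.
by apply/seteqP; split => x /=; rewrite lte_fin.
Qed.

Lemma measurable_normc_le f t : cmeasurable f ->
  measurable [set x | (normc (f x) <= t)%R].
Proof.
move=> mf; rewrite -[X in measurable X]setTI.
rewrite (_ : [set x | _] = [set x | (normc (f x))%:E <= t%:E]).
  by apply: emeasurable_fun_infty_c => //; exact: cmeasurable_normcE.
by apply/seteqP; split => x /=; rewrite lee_fin.
Qed.

Lemma cmeasurable_comp {d' : measure_display} {Y : measurableType d'}
    (h : Y -> X) f : measurable_fun setT h -> cmeasurable f ->
  cmeasurable (fun y => f (h y)).
Proof.
by move=> mh [fr fi]; split; [exact: (measurableT_comp fr mh)|exact: (measurableT_comp fi mh)].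
Qed.

End ComplexMeasurable.

(** * Integration of complex-valued functions and the space L^1 *)

Section ComplexIntegral.
Context {R : realType} {d : measure_display} {X : measurableType d}.
Variable mu : {measure set X -> \bar R}.
Implicit Types f g : X -> R[i].

Lemma cLnorm1E f : cLnorm mu 1 f = \int[mu]_x (normc (f x))%:E.
Proof.
rewrite /cLnorm Lnorm1; apply: eq_integral => x _ /=.
by rewrite ger0_norm ?normc_ge0.
Qed.

Lemma cLnorm2_sqr f :
  cLnorm mu 2 f `^ 2 = \int[mu]_x (normc (f x) ^+ 2)%:E.
Proof.
rewrite /cLnorm poweR_Lnorm//; apply: eq_integral => x _ /=.
by rewrite ger0_norm ?normc_ge0// powR_mulrn ?normc_ge0.
Qed.

Lemma cLnorm_ge0 p f : 0 <= cLnorm mu p f.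
Proof. exact: Lnorm_ge0. Qed.

Lemma normc_integral_ge0 D f : 0 <= \int[mu]_(x in D) (normc (f x))%:E.
Proof. by apply: integral_ge0 => x _; rewrite lee_fin normc_ge0. Qed.

Lemma cL1P f : cL mu 1 f <->
  cmeasurable f /\ \int[mu]_x (normc (f x))%:E < +oo.
Proof. by rewrite /cL /= cLnorm1E. Qed.

Lemma cL2P f : cL mu 2 f <->
  cmeasurable f /\ \int[mu]_x (normc (f x) ^+ 2)%:E < +oo.
Proof.
rewrite /cL /= -cLnorm2_sqr; split => -[mf h]; split => //.
  exact: poweR_lty.
exact: lty_poweRy h.
Qed.

Lemma integral_normcD D f g : measurable D -> cmeasurable f -> cmeasurable g ->
  \int[mu]_(x in D) (normc (f x + g x))%:E <=
  \int[mu]_(x in D) (normc (f x))%:E + \int[mu]_(x in D) (normc (g x))%:E.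
Proof.
move=> mD mf mg; rewrite -ge0_integralD//; first last.
- exact: cmeasurable_normcE.
- by move=> x _; rewrite lee_fin normc_ge0.
- exact: cmeasurable_normcE.
- by move=> x _; rewrite lee_fin normc_ge0.
apply: ge0_le_integral => //.
- by move=> x _; rewrite lee_fin normc_ge0.
- by apply: cmeasurable_normcE; exact: cmeasurableD.
- by apply: emeasurable_funD; exact: cmeasurable_normcE.
- by move=> x _; rewrite -EFinD lee_fin normcD.
Qed.

Lemma integral_normcZ D (c : R[i]) f : measurable D -> cmeasurable f ->
  \int[mu]_(x in D) (normc (c * f x))%:E =
  (normc c)%:E * \int[mu]_(x in D) (normc (f x))%:E.
Proof.
move=> mD mf; rewrite -ge0_integralZl//.
- by apply: eq_integral => x _; rewrite normcM EFinM.
- exact: cmeasurable_normcE.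
- by move=> x _; rewrite lee_fin normc_ge0.
- by rewrite lee_fin normc_ge0.
Qed.

Lemma integral_normcB D f g : measurable D -> cmeasurable f -> cmeasurable g ->
  \int[mu]_(x in D) (normc (f x - g x))%:E <=
  \int[mu]_(x in D) (normc (f x))%:E + \int[mu]_(x in D) (normc (g x))%:E.
Proof.
move=> mD mf mg; have mN : cmeasurable (fun x => -1 * g x)%R.
  by apply: cmeasurableM => //; exact: cmeasurable_cst.
have := integral_normcD mD mf mN.
rewrite integral_normcZ// normc_opp normc1 mul1e.
by under eq_integral => x _ do rewrite mulN1r.
Qed.

Lemma cL1D f g : cL mu 1 f -> cL mu 1 g -> cL mu 1 (fun x => (f x + g x)%R).
Proof.
move=> /cL1P[mf f1] /cL1P[mg g1]; apply/cL1P; split; first exact: cmeasurableD.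
by apply: le_lt_trans (integral_normcD _ mf mg) _ => //; exact: lte_add_pinfty.
Qed.

Lemma cL1Z (c : R[i]) f : cL mu 1 f -> cL mu 1 (fun x => (c * f x)%R).
Proof.
move=> /cL1P[mf f1]; apply/cL1P; split.
  by apply: cmeasurableM => //; exact: cmeasurable_cst.
rewrite integral_normcZ//; apply: lte_mul_pinfty => //.
by rewrite lee_fin normc_ge0.
Qed.

Lemma cL1B f g : cL mu 1 f -> cL mu 1 g -> cL mu 1 (fun x => (f x - g x)%R).
Proof.
move=> f1 g1; rewrite (_ : (fun x => _) = fun x => f x + (-1) * g x)%R.
  by apply: cL1D => //; exact: cL1Z.
by apply/funext => x; rewrite mulN1r.
Qed.

Lemma cL1_0 : cL mu 1 (fun=> 0%R).
Proof.
apply/cL1P; split; first exact: cmeasurable_cst.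
rewrite integral0_eq ?ltry// => x _; by rewrite normc0.
Qed.

Lemma cL1_le f g : cmeasurable f -> cL mu 1 g ->
  (forall x, (normc (f x) <= normc (g x))%R) -> cL mu 1 f.
Proof.
move=> mf /cL1P[mg g1] fg; apply/cL1P; split => //.
apply: le_lt_trans g1; apply: ge0_le_integral => //.
- by move=> x _; rewrite lee_fin normc_ge0.
- exact: cmeasurable_normcE.
- exact: cmeasurable_normcE.
- by move=> x _; rewrite lee_fin.
Qed.

Lemma cL1_integrable_Re f : cL mu 1 f ->
  mu.-integrable setT (EFin \o (fun x => complex.Re (f x))).
Proof.
move=> /cL1P[mf f1]; apply/integrableP; split.
  by apply/measurable_EFinP; exact: mf.1.
apply: le_lt_trans f1; apply: ge0_le_integral => //.
- by apply/measurableT_comp => //; apply/measurable_EFinP; exact: mf.1.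
- exact: cmeasurable_normcE.
- by move=> x _; rewrite /= lee_fin Re_le_normc.
Qed.

Lemma cL1_integrable_Im f : cL mu 1 f ->
  mu.-integrable setT (EFin \o (fun x => complex.Im (f x))).
Proof.
move=> /cL1P[mf f1]; apply/integrableP; split.
  by apply/measurable_EFinP; exact: mf.2.
apply: le_lt_trans f1; apply: ge0_le_integral => //.
- by apply/measurableT_comp => //; apply/measurable_EFinP; exact: mf.2.
- exact: cmeasurable_normcE.
- by move=> x _; rewrite /= lee_fin Im_le_normc.
Qed.

Lemma cintB f g : cL mu 1 f -> cL mu 1 g ->
  cint mu setT (fun x => (f x - g x)%R) = (cint mu setT f - cint mu setT g)%R.
Proof.
move=> f1 g1; rewrite /cint.
rewrite (_ : (fun x => complex.Re _) = fun x => complex.Re (f x) - complex.Re (g x))%R;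
  last by apply/funext => x; case: (f x) (g x) => ? ? [].
rewrite (_ : (fun x => complex.Im _) = fun x => complex.Im (f x) - complex.Im (g x))%R;
  last by apply/funext => x; case: (f x) (g x) => ? ? [].
by rewrite !RintegralB//; do ?[exact: cL1_integrable_Re|exact: cL1_integrable_Im].
Qed.

Lemma cintZ (c : R[i]) f : cL mu 1 f ->
  cint mu setT (fun x => (c * f x)%R) = (c * cint mu setT f)%R.
Proof.
move=> f1; have [iR iI] := (cL1_integrable_Re f1, cL1_integrable_Im f1).
case: c => a b; rewrite /cint.
rewrite (_ : (fun x => complex.Re _) = fun x => a * complex.Re (f x) - b * complex.Im (f x))%R;
  last by apply/funext => x; case: (f x).
rewrite (_ : (fun x => complex.Im _) = fun x => a * complex.Im (f x) + b * complex.Re (f x))%R;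
  last by apply/funext => x; case: (f x).
have iZ r (h : X -> R) : mu.-integrable setT (EFin \o h) ->
    mu.-integrable setT (EFin \o (fun x => r * h x)%R).
  move=> ih; rewrite (_ : _ \o _ = fun x => r%:E * (EFin \o h) x).
    exact: integrableZl.
  by apply/funext => x /=; rewrite EFinM.
rewrite RintegralB//; [|exact: iZ..]; rewrite RintegralD//; [|exact: iZ..].
by rewrite !RintegralZl.
Qed.

(** Real and imaginary parts are estimated separately, each by the integral of the modulus; hence
    the factor 2 in place of the sharp constant 1. *)
Lemma normc_cint_le f : cL mu 1 f ->
  (normc (cint mu setT f))%:E <= 2%:E * \int[mu]_x (normc (f x))%:E.
Proof.
move=> f1; have [iR iI] := (cL1_integrable_Re f1, cL1_integrable_Im f1).
have mf : cmeasurable f by have /cL1P[] := f1.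
apply: (@le_trans _ _ (`|Rintegral mu setT (fun x => complex.Re (f x))| +
                       `|Rintegral mu setT (fun x => complex.Im (f x))|)%:E).
  by rewrite lee_fin; exact: normc_le_ReIm.
have key (h : X -> R) : mu.-integrable setT (EFin \o h) ->
    (forall x, `|h x| <= normc (f x))%R ->
    `|Rintegral mu setT h|%:E <= \int[mu]_x (normc (f x))%:E.
  move=> ih hf; rewrite /Rintegral -abse_EFin fineK; last exact: integrable_fin_num.
  apply: le_trans (le_abse_integral _ _ _) _ => //; first exact: measurable_int ih.
  apply: ge0_le_integral => //.
  - by apply/measurableT_comp => //; exact: measurable_int ih.
  - exact: cmeasurable_normcE.
  - by move=> x _; rewrite /= lee_fin.
rewrite EFinD mule_natl mule2n leeD//; apply: key => // x.
  exact: Re_le_normc.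
exact: Im_le_normc.
Qed.

Lemma integral_normcB_eq0 (f g : X -> R[i]) : cmeasurable f -> cmeasurable g ->
  {ae mu, forall x, f x = g x} -> \int[mu]_x (normc (f x - g x))%:E = 0.
Proof.
move=> mf mg fg; rewrite (@ae_eq_integral _ _ _ mu setT (cst 0))//.
- by rewrite integral0.
- by apply: cmeasurable_normcE; exact: cmeasurableB.
- by apply: filterS fg => x -> _; rewrite subrr normc0.
Qed.

End ComplexIntegral.

(** * Convergence in measure *)

Section ConvergenceInMeasure.
Context {R : realType} {d : measure_display} {X : measurableType d}.
Variable mu : {measure set X -> \bar R}.

(** Both measures are integrals of indicators, and integrals only see almost everywhere
    inequalities. *)
Lemma ae_le_measure (A B : set X) : measurable A -> measurable B ->
  {ae mu, forall x, A x -> B x} -> mu A <= mu B.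
Proof.
move=> mA mB AB.
have mi (C : set X) : measurable C -> mu C = \int[mu]_x (\1_C x)%:E.
  by move=> mC; rewrite integral_indic// setIT.
rewrite !mi//; apply: ae_ge0_le_integral => //.
- by apply/measurable_EFinP; exact: measurable_indic.
- by apply/measurable_EFinP; exact: measurable_indic.
- apply: filterS AB => x ABx _; rewrite lee_fin !indicE ler_nat.
  case: (boolP (x \in A)) => // /set_mem/ABx Bx.
  by rewrite mem_set.
Qed.

(** A lower limit tolerates finitely many exceptional indices and a vanishing error, the two defects
    that Borel-Cantelli leaves at a point. *)
Lemma le_limn_einf (u : nat -> \bar R) (l : R) (eps : nat -> R) N :
  (forall k, (N <= k)%N -> l%:E <= u k + (eps k)%:E) ->
  eps @ \oo --> (0%R : R) ->
  l%:E <= limn_einf u.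
Proof.
move=> lu eps0; rewrite limn_einf_lim (cvg_lim _ (@cvg_einfs_sup _ u))//.
apply/lee_addgt0Pr => e e0.
have [M _ MP] := (@cvgrPdist_lt _ _ _ _ _ _ _).1 eps0 _ e0.
pose n := maxn M N.
apply: (@le_trans _ _ (einfs u n + e%:E)); last first.
  by apply: leeD2r; apply: ereal_sup_ubound; exists n.
rewrite -leeBlDr//; apply: le_ereal_inf_tmp => _ [k /= nk <-].
rewrite EFinN leeBlDr//; apply: le_trans (lu k _) _.
  by apply: leq_trans nk; exact: leq_maxr.
apply: leeD2l; rewrite lee_fin.
have /MP : (M <= k)%N by apply: leq_trans nk; exact: leq_maxl.
by rewrite /= sub0r normrN => /ltW; exact: le_trans (ler_norm _).
Qed.

Lemma limn_einf_le (u : nat -> \bar R) (M : \bar R) :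
  (forall k, u k <= M) -> limn_einf u <= M.
Proof.
move=> uM; rewrite limn_einf_lim (cvg_lim _ (@cvg_einfs_sup _ u))//.
apply: ge_ereal_sup => _ [n _ <-]; apply: le_trans (uM n).
by apply: ereal_inf_lbound; exists n => /=.
Qed.

(** Take approximants [G k] with errors [e k] that are summable. By Borel-Cantelli almost every
    point satisfies [|F - G k| <= e k] for all large [k], so [|F|] is at most the lower limit of
    [|G k|], and Fatou's lemma carries the bound [M] over. *)
Lemma integral_le_approx_in_measure (D : set X) (F : X -> R[i]) (M : \bar R) :
  measurable D -> cmeasurable F ->
  (forall e : R, (0 < e)%R -> exists G : X -> R[i], [/\ cmeasurable G,
     \int[mu]_(x in D) (normc (G x))%:E <= M &
     mu [set x | (e < normc (F x - G x))%R] <= e%:E]) ->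
  \int[mu]_(x in D) (normc (F x))%:E <= M.
Proof.
move=> mD mF approx.
(* Written in the shape that [epsilon_trick] sums, applied below to the zero series. *)
pose e (k : nat) : R := (1 / (2 ^ k.+1)%:R)%R.
have e0 k : (0 < e k)%R by rewrite divr_gt0// ltr0n expn_gt0.
have /choice[G GP] := fun k => approx _ (e0 k).
have mG k : cmeasurable (G k) by have [] := GP k.
pose E k := [set x | (e k < normc (F x - G k x))%R].
have mE k : measurable (E k).
  by apply: measurable_normc_gt; exact: cmeasurableB.
have E0 : mu (lim_sup_set E) = 0.
  apply: lim_sup_set_cvg0 => //.
  apply: (@le_lt_trans _ _ (\sum_(0 <= k <oo) (0 + (e k)%:E))).
    by apply: lee_nneseries => // k _; rewrite add0e; have [] := GP k.
  apply: le_lt_trans (epsilon_trick _ _ _) _ => //.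
  by rewrite eseries0// add0e ltry.
have mls : measurable (lim_sup_set E).
  by apply: bigcap_measurableType => k _; exact: bigcup_measurable.
apply: (@le_trans _ _
    (\int[mu]_(x in D) limn_einf (fun k => (normc (G k x))%:E))).
  apply: ae_ge0_le_integral => //.
  - by move=> x _; rewrite lee_fin normc_ge0.
  - exact: cmeasurable_normcE.
  - move=> x _; apply: (@le_limn_einf _ 0 (fun=> 0%R) 0) => [k _|].
      by rewrite adde0 lee_fin normc_ge0.
    exact: cvg_cst.
  (* Unfolding the lower limit as an upper limit of negatives gives access to
     [measurable_fun_limn_esup]. *)
  - rewrite (_ : (fun x => _) = fun x =>
        - limn_esup (fun k => - (normc (G k x))%:E)) //.
    apply: measurableT_comp => //; apply: measurable_fun_limn_esup => k.
    by apply: measurableT_comp => //; exact: cmeasurable_normcE.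
  - exists (lim_sup_set E); split => //= x /not_implyP[Dx].
    apply: contra_notP => nEx.
    have [N NP] : exists N, forall k, (N <= k)%N -> ~ E k x.
      apply: contrapT => /forallNP h; apply: nEx => N _.
      have /existsNP[k /not_implyP[Nk /contrapT Ekx]] := h N.
      by exists k.
    apply: (@le_limn_einf _ _ e N) => [k /NP/negP|].
      rewrite -leNgt => Fk; rewrite -EFinD lee_fin.
      have := normcD (F x - G k x)%R (G k x); rewrite subrK.
      by move/le_trans; apply; rewrite addrC lerD2l.
    rewrite (_ : e = fun k => 2^-1 * 2^-1 ^+ k)%R; last first.
      by apply/funext => k; rewrite /e -exprS exprVn natrX div1r.
    rewrite -[X in _ --> X](mulr0 2^-1%R); apply: cvgMl_tmp.
    by apply: cvg_expr; rewrite ger0_norm// invf_lt1// ltr1n.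
apply: le_trans (fatou _ _ _ _) _ => //.
- by move=> k; exact: cmeasurable_normcE.
- by move=> k x _; rewrite lee_fin normc_ge0.
- by apply: limn_einf_le => k; have [] := GP k.
Qed.

End ConvergenceInMeasure.

(** * Weak type bounds *)

Section WeakType.
Context {R : realType} {d : measure_display} {X : measurableType d}.
Variable mu : {measure set X -> \bar R}.
Variables T T1 : (X -> R[i]) -> (X -> R[i]).
Implicit Types f g : X -> R[i].

Lemma chebyshev2 f (t : R) : cmeasurable f -> (0 < t)%R ->
  (t ^+ 2)%:E * mu [set x | (t < normc (f x))%R] <=
  \int[mu]_x (normc (f x) ^+ 2)%:E.
Proof.
move=> mf t0; set E := [set x | _].
have mE : measurable E by exact: measurable_normc_gt.
have mf2 D : measurable_fun D (fun x => (normc (f x) ^+ 2)%:E).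
  apply/measurable_EFinP; apply: measurable_funX.
  by apply: (measurable_funS measurableT) => //; exact: cmeasurable_normc.
rewrite -integral_cst//.
apply: (@le_trans _ _ (\int[mu]_(x in E) (normc (f x) ^+ 2)%:E)).
  apply: ge0_le_integral => //.
  - by move=> x _; rewrite lee_fin sqr_ge0.
  - by move=> x /ltW tx; rewrite lee_fin lerXn2r// nnegrE ?normc_ge0// ltW.
by apply: ge0_subset_integral => // x _; rewrite lee_fin sqr_ge0.
Qed.

(** The operator bound squared, so that it compares plain integrals, as Chebyshev's inequality does.
    The given [C] carries no sign, hence [|C|] before squaring. *)
Lemma L2_bounded_sqr : L2_bounded_operator mu T ->
  exists2 C : R, (0 <= C)%R & forall f, cL mu 2 f ->
    cmeasurable (T f) /\
    \int[mu]_x (normc (T f x) ^+ 2)%:E <=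
      C%:E * \int[mu]_x (normc (f x) ^+ 2)%:E.
Proof.
move=> [_ [C TC]]; exists (`|C| ^+ 2)%R; first exact: sqr_ge0.
move=> f f2; have [[mTf _] Tf2] := TC f f2; split => //.
rewrite -!cLnorm2_sqr -powR_mulrn// -poweR_EFin -poweRM//; last first.
  exact: cLnorm_ge0.
apply: gt0_ler_poweR => //.
- by rewrite in_itv /= leey andbT cLnorm_ge0.
- by rewrite in_itv /= leey andbT mule_ge0// cLnorm_ge0.
- apply: (le_trans Tf2); apply: lee_wpmul2r; first exact: cLnorm_ge0.
  by rewrite lee_fin ler_norm.
Qed.

Hypothesis T1T : L1_extension mu T T1.

Lemma L1_ext_weak11 : exists2 C : R, (0 <= C)%R & forall f, cL mu 1 f ->
  forall t : R, (0 < t)%R ->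
  t%:E * mu [set x | (t < normc (T1 f x))%R] <=
    C%:E * \int[mu]_x (normc (f x))%:E.
Proof.
have [_ _ [C TC]] := T1T; exists `|C|%R => // f f1 t t0.
apply: (@le_trans _ _ (C%:E * cLnorm mu 1 f)).
  apply: le_trans (TC f f1).2; apply: ereal_sup_ubound; exists t => //=.
  by rewrite in_itv /= t0.
rewrite -cLnorm1E; apply: lee_wpmul2r; first exact: cLnorm_ge0.
by rewrite lee_fin ler_norm.
Qed.

Lemma L1_ext_measurable f : cL mu 1 f -> cmeasurable (T1 f).
Proof. by move=> f1; have [_ _ [C TC]] := T1T; have [] := TC f f1. Qed.

Lemma L1_extZD (c : R[i]) f g : cL mu 1 f -> cL mu 1 g ->
  {ae mu, forall x, T1 (fun y => (c * f y + g y)%R) x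
                    = (c * T1 f x + T1 g x)%R}.
Proof. by have [lin _ _] := T1T; exact: lin. Qed.

Lemma L1_extD f g : cL mu 1 f -> cL mu 1 g ->
  {ae mu, forall x, T1 (fun y => (f y + g y)%R) x = (T1 f x + T1 g x)%R}.
Proof.
move=> f1 g1; have := L1_extZD 1%R f1 g1.
rewrite (_ : (fun y => 1 * f y + g y)%R = (fun y => f y + g y)%R); last first.
  by apply/funext => y; rewrite mul1r.
by apply: filterS => x ->; rewrite mul1r.
Qed.

(** The weak (1,1) bound for [f - g] makes [T1 g] close to [T1 f] in measure once [g] is close to
    [f] in L^1; the previous criterion then applies. *)
Lemma L1_ext_integral_le_approx (D : set X) f (M : \bar R) :
  measurable D -> cL mu 1 f ->
  (forall e : R, (0 < e)%R -> exists g, [/\ cL mu 1 g,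
     \int[mu]_x (normc (f x - g x))%:E <= e%:E &
     \int[mu]_(x in D) (normc (T1 g x))%:E <= M]) ->
  \int[mu]_(x in D) (normc (T1 f x))%:E <= M.
Proof.
move=> mD f1 approx; apply: integral_le_approx_in_measure => //.
  exact: L1_ext_measurable.
move=> e e0; have [C C0 wC] := L1_ext_weak11.
have C10 : (0 < C + 1)%R by rewrite ltr_wpDl.
(* At this L^1 distance the weak bound at height [e] gives measure at most [C e / (C + 1) <= e]. The
   [+ 1] covers [C = 0]. *)
have e'0 : (0 < e ^+ 2 / (C + 1))%R by rewrite divr_gt0// exprn_gt0.
have [g [g1 fg TgM]] := approx _ e'0; exists (T1 g); split => //.
  exact: L1_ext_measurable.
have h1 := cL1B f1 g1.
apply: (@le_trans _ _ (mu [set x | (e < normc (T1 (fun y => f y - g y) x))%R])).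
  apply: ae_le_measure.
  - by apply: measurable_normc_gt; apply: cmeasurableB; exact: L1_ext_measurable.
  - by apply: measurable_normc_gt; exact: L1_ext_measurable.
  have := L1_extD h1 g1.
  rewrite (_ : (fun y => f y - g y + g y)%R = f); last first.
    by apply/funext => y; rewrite subrK.
  by apply: filterS => x /= ->; rewrite addrK.
rewrite -(@lee_pmul2l _ e%:E)// ?lte_fin//.
apply: le_trans (wC _ h1 _ e0) _.
apply: (@le_trans _ _ ((C + 1)%:E * (e ^+ 2 / (C + 1))%:E)).
  apply: lee_pmul => //.
  - exact: normc_integral_ge0.
  - by rewrite lee_fin lerDl.
by rewrite -!EFinM mulrCA divff ?gt_eqF// mulr1 expr2.
Qed.

(** [T1] acts on functions and not on classes, so changing [f] on a null set needs an argument: [g]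
    approximates [f] in L^1 with error zero. *)
Lemma L1_ext_integral_le_ae D (f g : X -> R[i]) (M : \bar R) : measurable D ->
  cL mu 1 f -> cL mu 1 g -> {ae mu, forall x, f x = g x} ->
  \int[mu]_(x in D) (normc (T1 g x))%:E <= M ->
  \int[mu]_(x in D) (normc (T1 f x))%:E <= M.
Proof.
move=> mD f1 g1 fg TgM; apply: L1_ext_integral_le_approx => // e e0.
exists g; split => //; rewrite integral_normcB_eq0 ?lee_fin ?ltW//.
  by case/cL1P: f1.
by case/cL1P: g1.
Qed.

(** Additivity at [0 + 0] forces [T1 0 = 0] almost everywhere. *)
Lemma L1_ext0 : \int[mu]_x (normc (T1 (fun=> 0%R) x))%:E = 0.
Proof.
have z1 := cL1_0 mu; have mTz := L1_ext_measurable z1.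
rewrite (@ae_eq_integral _ _ _ mu setT (cst 0))//.
- by rewrite integral0.
- exact: cmeasurable_normcE.
have := L1_extD z1 z1.
rewrite (_ : (fun y : X => 0 + 0)%R = (fun=> 0%R)); last first.
  by apply/funext => y; rewrite addr0.
apply: filterS => x Tx _.
by rewrite (_ : T1 _ x = 0%R) ?normc0//; apply: (addrI (T1 (fun=> 0%R) x)); rewrite addr0.
Qed.

(** Split [u ^ 2 = u ^ (2 - q) u ^ q]; the first factor increases with [u] as [2 - q >= 0]. This
    controls the part of a function below height [t]. *)
Lemma sqr_le_powR (u t q : R) : (q <= 2)%R -> (0 <= u)%R -> (u <= t)%R ->
  (0 < q)%R -> (u ^+ 2 <= t `^ (2 - q) * u `^ q)%R.
Proof.
move=> q2 u0 ut q0; have [->|un0] := eqVneq u 0%R.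
  by rewrite expr0n /= mulr_ge0// powR_ge0.
have -> : (u ^+ 2 = u `^ (2 - q) * u `^ q)%R.
  by rewrite -powRD ?un0 ?implybT// subrK powR_mulrn.
rewrite ler_wpM2r ?powR_ge0// ge0_ler_powR// ?subr_ge0// nnegrE//.
exact: le_trans ut.
Qed.

(** The counterpart above height [t]: in [u = u ^ (1 - q) u ^ q] the exponent [1 - q] is
    nonpositive, so the first factor decreases with [u]. *)
Lemma le_powR_of_lt (u t q : R) : (1 <= q)%R -> (0 < t)%R -> (t < u)%R ->
  (u <= t `^ (1 - q) * u `^ q)%R.
Proof.
move=> q1 t0 tu; have u0 := lt_trans t0 tu.
have {1}-> : (u = u `^ (1 - q) * u `^ q)%R.
  by rewrite -powRD ?(gt_eqF u0) ?implybT// subrK powRr1// ltW.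
rewrite ler_wpM2r ?powR_ge0// -opprB !powRN lef_pV2 ?posrE ?powR_gt0//.
by rewrite ge0_ler_powR// ?subr_ge0// ?nnegrE ltW.
Qed.

Lemma measurable_normc_powR D f q : cmeasurable f ->
  measurable_fun D (fun x => (normc (f x) `^ q)%:E).
Proof.
move=> mf; apply/measurable_EFinP; apply: (measurable_funS measurableT) => //.
apply: (@measurableT_comp _ _ _ _ _ _ (@powR R ^~ q)).
  exact: measurable_powR.
exact: cmeasurable_normc.
Qed.

Lemma powR_integral_ge0 D f q : 0 <= \int[mu]_(x in D) (normc (f x) `^ q)%:E.
Proof. by apply: integral_ge0 => x _; rewrite lee_fin powR_ge0. Qed.

(* Splitting [f] at height [t]: the large part is handled by the weak (1,1)
   bound, the small part by the L^2 bound and Chebyshev. *)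
Lemma L1_ext_weakqq q : L2_bounded_operator mu T -> (1 <= q)%R -> (q <= 2)%R ->
  exists2 C : R, (0 <= C)%R & forall f, cL mu 1 f ->
  forall t : R, (0 < t)%R ->
  mu [set x | (t < normc (T1 f x))%R] <=
    (C * t `^ (- q))%:E * \int[mu]_x (normc (f x) `^ q)%:E.
Proof.
move=> T2 q1 q2; have q0 : (0 < q)%R by exact: lt_le_trans q1.
have [C1 C10 wC] := L1_ext_weak11; have [C2 C20 sC] := L2_bounded_sqr T2.
(* Each part is tested at height [t / 2]: Chebyshev contributes [(t / 2) ^ -2], hence 4, and the
   weak (1,1) bound [(t / 2) ^ -1], hence 2. *)
exists (4 * C2 + 2 * C1)%R; first by rewrite addr_ge0// mulr_ge0.
move=> f f1 t t0; have /cL1P[mf _] := f1.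
set I := \int[mu]_x _; have I0 : 0 <= I by exact: powR_integral_ge0.
pose S := [set x | (normc (f x) <= t)%R].
have mS : measurable S by exact: measurable_normc_le.
pose b x := ((\1_S x : R)%:C * f x)%R.
pose c x := (f x - b x)%R.
have bE x : b x = if (normc (f x) <= t)%R then f x else 0%R.
  rewrite /b indicE; case: ifPn => h.
    by rewrite mem_set//= mul1r.
  by rewrite memNset ?mul0r//; exact/negP.
have mb : cmeasurable b by apply: cmeasurableM => //; exact: cmeasurable_indic.
have b1 : cL mu 1 b.
  apply: cL1_le f1 _ => // x; rewrite bE; case: ifPn => // _.
  by rewrite normc0 normc_ge0.
have c1 : cL mu 1 c by exact: cL1B.
have b2I : \int[mu]_x (normc (b x) ^+ 2)%:E <= (t `^ (2 - q))%:E * I.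
  rewrite /I -ge0_integralZl//; first last.
  - by rewrite lee_fin powR_ge0.
  - by move=> x _; rewrite lee_fin powR_ge0.
  - exact: measurable_normc_powR.
  apply: ge0_le_integral => //.
  - by move=> x _; rewrite lee_fin sqr_ge0.
  - by apply/measurable_EFinP; apply: measurable_funX; exact: cmeasurable_normc.
  - apply: measurable_funeM; exact: measurable_normc_powR.
  move=> x _; rewrite -EFinM lee_fin bE; case: ifPn => ft.
    by apply: sqr_le_powR => //; exact: normc_ge0.
  by rewrite normc0 expr0n mulr_ge0// powR_ge0.
(* Membership in L^2 comes from [|b| ^ 2 <= t |f|] with [f] in L^1; the bound by [I] is of no help
   here, since [I] may be infinite. *)
have b2 : cL mu 2 b.
  apply/cL2P; split => //.
  apply: (@le_lt_trans _ _ (t%:E * \int[mu]_x (normc (f x))%:E)).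
    rewrite -ge0_integralZl//; first last.
    - by rewrite lee_fin ltW.
    - by move=> x _; rewrite lee_fin normc_ge0.
    - exact: cmeasurable_normcE.
    apply: ge0_le_integral => //.
    - by move=> x _; rewrite lee_fin sqr_ge0.
    - by apply/measurable_EFinP; apply: measurable_funX; exact: cmeasurable_normc.
    - apply: measurable_funeM; exact: cmeasurable_normcE.
    move=> x _; rewrite -EFinM lee_fin bE; case: ifPn => ft.
      by rewrite expr2 ler_wpM2r// normc_ge0.
    by rewrite normc0 expr0n mulr_ge0// ?normc_ge0// ltW.
  by apply: lte_mul_pinfty => //; [rewrite lee_fin ltW|case/cL1P: f1].
have cI : \int[mu]_x (normc (c x))%:E <= (t `^ (1 - q))%:E * I.
  rewrite /I -ge0_integralZl//; first last.
  - by rewrite lee_fin powR_ge0.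
  - by move=> x _; rewrite lee_fin powR_ge0.
  - exact: measurable_normc_powR.
  apply: ge0_le_integral => //.
  - by move=> x _; rewrite lee_fin normc_ge0.
  - by apply: cmeasurable_normcE; case/cL1P: c1.
  - apply: measurable_funeM; exact: measurable_normc_powR.
  move=> x _; rewrite -EFinM lee_fin /c bE; case: ifPn => ft.
    by rewrite subrr normc0 mulr_ge0// powR_ge0.
  by rewrite subr0; apply: le_powR_of_lt => //; rewrite ltNge.
have t20 : (0 < t / 2)%R by rewrite divr_gt0.
pose U g := [set x | (t / 2 < normc (T1 g x))%R].
have mU g : cL mu 1 g -> measurable (U g).
  by move=> g1; apply: measurable_normc_gt; exact: L1_ext_measurable.
apply: (@le_trans _ _ (mu (U b `|` U c))).
  apply: ae_le_measure.
  - by apply: measurable_normc_gt; exact: L1_ext_measurable.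
  - by apply: measurableU; exact: mU.
  have := L1_extD b1 c1.
  rewrite (_ : (fun y => b y + c y)%R = f); last first.
    by apply/funext => y; rewrite /c addrC subrK.
  apply: filterS => x /= -> tx; apply: contrapT => /not_orP[/negP + /negP].
  rewrite -!leNgt => bt ct; move: tx; apply/negP; rewrite -leNgt.
  by apply: le_trans (normcD _ _) _; rewrite (splitr t) lerD.
apply: le_trans (measureU2 _ (mU _ b1) (mU _ c1)) _.
rewrite mulrDl EFinD ge0_muleDl ?lee_fin ?mulr_ge0 ?powR_ge0//.
apply: leeD.
- apply: (@le_trans _ _ (mu [set x | (t / 2 < normc (T b x))%R])).
    have TT : {ae mu, forall x, T1 b x = T b x} by have [_ + _] := T1T; apply.
    have [mTb _] := sC b b2.
    apply: ae_le_measure; [exact: mU|exact: measurable_normc_gt|].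
    apply: filterS TT => x TTx. by rewrite /U /= TTx.
  have t220 : (0 < (t / 2) ^+ 2)%R by rewrite exprn_gt0.
  have [mTb Tb2] := sC b b2.
  rewrite -(@lee_pmul2l _ ((t / 2) ^+ 2)%:E)// ?lte_fin//.
  apply: le_trans (chebyshev2 mTb t20) _.
  apply: (le_trans Tb2).
  apply: (@le_trans _ _ (C2%:E * ((t `^ (2 - q))%:E * I))).
    by apply: lee_wpmul2l.
  rewrite !muleA -!EFinM lee_wpmul2r// lee_fin.
  rewrite powRD ?(gt_eqF t0) ?implybT// powR_mulrn ?(ltW t0)//.
  by rewrite le_eqVlt; apply/orP; left; apply/eqP; field.
- rewrite -(@lee_pmul2l _ (t / 2)%:E)// ?lte_fin//.
  apply: le_trans (wC _ c1 _ t20) _.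
  apply: (@le_trans _ _ (C1%:E * ((t `^ (1 - q))%:E * I))).
    by apply: lee_wpmul2l.
  rewrite !muleA -!EFinM lee_wpmul2r// lee_fin.
  rewrite powRD ?(gt_eqF t0) ?implybT// powRr1 ?(ltW t0)//.
  by rewrite le_eqVlt; apply/orP; left; apply/eqP; field.
Qed.

End WeakType.

(** * From weak type to local integrability *)

Section LayerCake.
Context {R : realType} {d : measure_display} {X : measurableType d}.
Variable mu : {measure set X -> \bar R}.

Lemma powR2_lt1 (q : R) : (1 < q)%R -> (2 `^ (1 - q) < 1 :> R)%R.
Proof.
move=> q1; rewrite -opprB powRN invf_lt1 ?powR_gt0//.
have {1}<- : (1 `^ (q - 1) = 1 :> R)%R by rewrite powR1.
by rewrite gt0_ltr_powR ?subr_gt0 ?nnegrE ?ltr1n.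
Qed.

Lemma powRVM (m p : R) : (0 < m)%R -> (m^-1 `^ p * m `^ p = 1)%R.
Proof.
by move=> m0; rewrite -powRM ?invr_ge0 ?(ltW m0)// mulVf ?gt_eqF// powR1.
Qed.

(** A discrete layer-cake formula: if [2 ^ n s < u <= 2 ^ (n + 1) s], the term [k = n] alone is at
    least [u]. *)
Lemma dyadic_layer (u s : R) : (0 < s)%R ->
  u%:E <= s%:E + \sum_(0 <= k <oo)
    ((2 ^+ k.+1 * s) * ((2 ^+ k * s < u)%R : nat)%:R)%:E.
Proof.
move=> s0; have t0 k : (0 <= 2 ^+ k.+1 * s * ((2 ^+ k * s < u)%R : nat)%:R)%R.
  by rewrite !mulr_ge0// ?exprn_ge0// ltW.
have [us|su] := leP u s.
  rewrite -[leLHS]adde0 leeD ?lee_fin//.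
  by apply: nneseries_ge0 => k _ _; rewrite lee_fin.
have ex : exists n, (u <= 2 ^+ n * s)%R.
  exists (Num.Def.archi_bound (u / s)); rewrite -ler_pdivrMr// ltW//.
  exact: upper_nthrootP.
(* The least exponent is positive because [s < u]; its predecessor [n] indexes the dominating
   term. *)
case: (ex_minnP ex) => -[|n] un nmin.
  by move: un; rewrite expr0 mul1r leNgt su.
have nu : (2 ^+ n * s < u)%R.
  by rewrite ltNge; apply/negP => /nmin; rewrite ltnn.
apply: (@le_trans _ _ (2 ^+ n.+1 * s)%:E); first by rewrite lee_fin.
rewrite -[leLHS]add0e leeD//; first by rewrite lee_fin ltW.
apply: (le_trans _ (@nneseries_lim_ge _ _ predT 0 n.+1 _)); last first.
  by move=> k _ _; rewrite lee_fin.
rewrite big_nat_recr//= -[leLHS]add0e leeD//.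
  by apply: sume_ge0 => k _; rewrite lee_fin.
by rewrite nu mulr1.
Qed.

Lemma nneseries_geometric_le (a r : R) : (0 <= a)%R -> (0 < r)%R -> (r < 1)%R ->
  \sum_(0 <= k <oo) (a * r ^+ k)%:E <= (a / (1 - r))%:E.
Proof.
move=> a0 r0 r1; apply: lime_le.
  apply: is_cvg_nneseries => k _ _.
  by rewrite lee_fin mulr_ge0// exprn_ge0// ltW.
apply: nearW => n; rewrite sumEFin lee_fin.
by apply: geometric_le_lim => //; rewrite ger0_norm// ltW.
Qed.

(** Values up to [s] cost [s mu(E)]. The layer at [2 ^ k s] costs at most
    [2 ^ (k + 1) s (2 ^ k s) ^ (- q) J], that is [2 s ^ (1 - q) J] times the [k]-th power of
    [2 ^ (1 - q)]; this ratio is below 1 because [q > 1]. *)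
Lemma weak_type_integral_le (F : X -> R[i]) (E : set X) (q s : R) (J : \bar R) :
  cmeasurable F -> measurable E -> (0 < s)%R -> (1 < q)%R -> 0 <= J ->
  (forall t, (0 < t)%R ->
     mu [set x | (t < normc (F x))%R] <= (t `^ (- q))%:E * J) ->
  \int[mu]_(x in E) (normc (F x))%:E <=
    s%:E * mu E + (2 * s `^ (1 - q) / (1 - 2 `^ (1 - q)))%:E * J.
Proof.
move=> mF mE s0 q1 J0 wF.
pose V k := [set x | (2 ^+ k * s < normc (F x))%R].
have mV k : measurable (V k) by exact: measurable_normc_gt.
have c0 k : (0 <= 2 ^+ k.+1 * s)%R by rewrite mulr_ge0 ?exprn_ge0// ltW.
have mf k : measurable_fun E (fun x => (2 ^+ k.+1 * s * \1_(V k) x)%:E).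
  apply/measurable_EFinP; apply: measurable_funM; first exact: measurable_cst.
  exact: measurable_indic.
have f0 k x : E x -> 0 <= (2 ^+ k.+1 * s * \1_(V k) x)%:E.
  by move=> _; rewrite lee_fin mulr_ge0.
apply: (@le_trans _ _ (\int[mu]_(x in E) (s%:E +
   \sum_(0 <= k <oo) (2 ^+ k.+1 * s * \1_(V k) x)%:E))).
  apply: ge0_le_integral => //.
  - by move=> x _; rewrite lee_fin normc_ge0.
  - exact: cmeasurable_normcE.
  - apply: emeasurable_funD => //.
    by apply: ge0_emeasurable_sum => [k x Ex _|k _]; [exact: f0|exact: mf].
  move=> x Ex; apply: (le_trans (dyadic_layer (normc (F x)) s0)).
  rewrite leeD2l//; apply: lee_nneseries => k _ //.
    by rewrite lee_fin mulr_ge0.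
  rewrite lee_fin indicE ler_wpM2l// ler_nat.
  case: (boolP (_ < _)%R) => // h; rewrite mem_set//.
rewrite ge0_integralD//; first last.
- by apply: ge0_emeasurable_sum => [k x Ex _|k _]; [exact: f0|exact: mf].
- by move=> x Ex; apply: nneseries_ge0 => k _ _; exact: f0.
- by move=> x _; rewrite lee_fin ltW.
rewrite integral_cst// leeD2l// integral_nneseries//.
have fin k : \int[mu]_(x in E) (2 ^+ k.+1 * s * \1_(V k) x)%:E <=
   (2 * s `^ (1 - q) * (2 `^ (1 - q)) ^+ k)%:E * J.
  under eq_integral do rewrite EFinM.
  rewrite ge0_integralZl ?lee_fin//; first last.
    by apply/measurable_EFinP; exact: measurable_indic.
  rewrite integral_indic//.
  have t0 : (0 < 2 ^+ k * s)%R by rewrite mulr_gt0// exprn_gt0.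
  apply: (@le_trans _ _ ((2 ^+ k.+1 * s)%:E * (((2 ^+ k * s) `^ (- q))%:E * J))).
    rewrite lee_wpmul2l ?lee_fin//; apply: le_trans (wF _ t0).
    by apply: le_measure; rewrite ?inE; [exact: measurableI|exact: mV|exact: subIsetl].
  rewrite muleA -EFinM lee_wpmul2r// lee_fin.
  have -> : ((2 `^ (1 - q)) ^+ k = (2 ^+ k) `^ (1 - q) :> R)%R.
    by rewrite -!powR_mulrn ?powR_ge0// -!powRrM mulrC.
  have p0 : (0 < 2 ^+ k :> R)%R by rewrite exprn_gt0.
  rewrite powRM ?(ltW p0) ?(ltW s0)// !powRD ?(gt_eqF s0) ?(gt_eqF p0) ?implybT//.
  rewrite !powRr1 ?(ltW p0) ?(ltW s0)// exprS le_eqVlt; apply/orP; left; apply/eqP.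
  by ring.
have r0 : (0 < 2 `^ (1 - q) :> R)%R by rewrite powR_gt0.
have r1 := powR2_lt1 q1.
have a0 : (0 <= 2 * s `^ (1 - q))%R by rewrite mulr_ge0// powR_ge0.
(* For infinite [J] the right-hand side is infinite, its coefficient being strictly positive. *)
have [Jy|Jfin] := eqVneq J +oo.
  rewrite Jy gt0_muley ?leey// lte_fin.
  by rewrite divr_gt0 ?mulr_gt0 ?powR_gt0// subr_gt0.
have {Jfin} : J \is a fin_num by rewrite ge0_fin_numE// ltey.
case: J J0 fin {wF} => // j j0 fin _.
apply: (@le_trans _ _ (\sum_(0 <= k <oo)
    (j%:E * (2 * s `^ (1 - q) * (2 `^ (1 - q)) ^+ k)%:E))).
  apply: lee_nneseries => [k _ _|k _]; first by apply: integral_ge0 => x; exact: f0.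
  by rewrite muleC; exact: fin.
rewrite nneseriesZl//; last first.
  by move=> k _; rewrite lee_fin mulr_ge0// exprn_ge0// ltW.
rewrite muleC lee_wpmul2r//.
exact: nneseries_geometric_le.
Qed.

End LayerCake.

(** * The part away from the enlarged set *)

Section Star.
Context (R : realType) (d : measure_display) (X : metricMeasurableType R d).
Variable rad : set X -> R.
Implicit Types (A : set X) (x y : X).

(** As a union of balls the enlarged set is visibly open, hence measurable under
    [borel_compatible]. *)
Lemma starE A : star rad A = \bigcup_(y in A) ball y (rad A).
Proof.
apply/seteqP; split => [x|x [y Ay]].
  move=> /ereal_inf_lt[_ [y Ay <-]]; rewrite lte_fin => xy.
  by exists y => //; rewrite ballEmdist /= metric_sym.
rewrite ballEmdist /= metric_sym => xy.
apply: (@le_lt_trans _ _ (mdist x y)%:E); last by rewrite lte_fin.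
by apply: ereal_inf_lbound; exists y.
Qed.

Lemma open_mdist_ball x (r : R) : open (ball x r).
Proof.
rewrite openE => y; rewrite ballEmdist /= => xy.
apply/nbhs_ballP; exists (r - mdist x y)%R; first by rewrite /= subr_gt0.
move=> z; rewrite ballEmdist /= => yz.
by apply: le_lt_trans (metric_triangle x y z) _; rewrite -ltrBrDl.
Qed.

Lemma measurable_star A : borel_compatible X -> measurable (star rad A).
Proof.
move=> bX; apply: bX; rewrite starE; apply: bigcup_open => y _.
exact: open_mdist_ball.
Qed.

(** The kernel formula holds off [fsupport], which is a closure; this makes it available off the
    enlarged set. *)
Lemma closure_sub_star A : (0 < rad A)%R -> closure A `<=` star rad A.
Proof.
move=> r0 x /(_ (ball x (rad A)) (nbhsx_ballx _ _ r0))[y [Ay xy]].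
by rewrite starE; exists y => //; exact: ball_sym.
Qed.

(** Supplies the bounded support that the kernel formula asks for. *)
Lemma closure_sub_ball A (c : X) (s : R) : (0 < s)%R -> A `<=` ball c s ->
  closure A `<=` ball c (s + s).
Proof.
move=> s0 As x /(_ (ball x s) (nbhsx_ballx _ _ s0))[y [/As cy xy]].
by apply: ball_triangle cy _; exact: ball_sym.
Qed.

End Star.

(** * The kernel formula combined with the Hormander condition *)

Section OffStar.
Context (R : realType) (d : measure_display) (X : metricMeasurableType R d).
Variable mu : {sigma_finite_measure set X -> \bar R}.
Variables (calR : set (set X)) (kappa0 : R) (rad : set X -> R).
Variables (T : (X -> R[i]) -> (X -> R[i])) (K : X * X -> R[i]).
Hypothesis bX : borel_compatible X.
Hypothesis CZ : CZ_space mu calR kappa0 rad.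
Hypothesis mK : cmeasurable K.
Hypothesis TK : kernel_off_diagonal mu T K.

Lemma hormander_le A y z : calR A -> A y -> A z ->
  \int[mu]_(x in ~` star rad A) (normc (K (x, y) - K (x, z)))%:E <=
  hormander_sup mu calR rad K.
Proof.
move=> RA Ay Az.
apply: (@le_trans _ _ (ereal_sup [set
   \int[mu]_(x in ~` star rad A) (normc (K (x, yz.1) - K (x, yz.2)))%:E
      | yz in A `*` A])).
  by apply: ereal_sup_ubound; exists (y, z).
by apply: ereal_sup_ubound; exists A.
Qed.

(** A point of [A] matters here: a supremum over no pairs would be [-oo]. *)
Lemma hormander_ge0 A : calR A -> A !=set0 -> 0 <= hormander_sup mu calR rad K.
Proof.
move=> RA [z Az]; apply: le_trans (hormander_le RA Az Az).
exact: normc_integral_ge0.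
Qed.

(** Since [b] has mean zero, subtracting [K (x, z)] from the kernel leaves the integral unchanged.
    The factor 2 is that of [normc_cint_le]. *)
Lemma off_star_ae A z b : calR A -> A z -> cL mu 1 b -> cL mu 2 b ->
  (forall x, ~ A x -> b x = 0%R) -> cint mu setT b = 0%R ->
  {ae mu, forall x, ~ star rad A x -> (normc (T b x))%:E <=
     2%:E * \int[mu]_y (normc ((K (x, y) - K (x, z)) * b y))%:E}.
Proof.
move=> RA Az b1 b2 bA bint.
have [_ _ /(_ A RA)[r0 [c [s [s0 _ As]]] _] _] := CZ.
have supA : fsupport b `<=` closure A.
  by apply: closureS => x bx; apply: contrapT => /bA.
have := TK b2; case.
  by exists c, (s + s)%R => x /supA; exact: closure_sub_ball.
move=> N [mN N0 sN]; exists N; split => //.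
apply: subset_trans sN => x; apply: contra_not => /= TKx nx.
have [Kb1 ->] := TKx (fun h => nx (closure_sub_star r0 (supA _ h))).
have Kzb : cL mu 1 (fun y => (K (x, z) * b y)%R) by exact: cL1Z.
have KB : (fun y => (K (x, y) - K (x, z)) * b y)%R =
          (fun y => K (x, y) * b y - K (x, z) * b y)%R.
  by apply/funext => y; rewrite mulrBl.
have -> : cint mu setT (fun y => (K (x, y) * b y)%R) =
          cint mu setT (fun y => ((K (x, y) - K (x, z)) * b y)%R).
  by rewrite KB cintB// cintZ// bint mulr0 subr0.
apply: normc_cint_le.
by rewrite KB; exact: cL1B.
Qed.

(** Integrate the pointwise bound and exchange the integrals by Tonelli. For [y] in [A] the inner
    integral is [|b y|] times a Hormander integral; for other [y] it vanishes with [b y]. *)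
Lemma off_star_le A b : calR A -> A !=set0 -> cL mu 1 b -> cL mu 2 b ->
  cmeasurable (T b) ->
  (forall x, ~ A x -> b x = 0%R) -> cint mu setT b = 0%R ->
  \int[mu]_(x in ~` star rad A) (normc (T b x))%:E <=
  2%:E * (hormander_sup mu calR rad K * \int[mu]_x (normc (b x))%:E).
Proof.
move=> RA A0 b1 b2 mTb bA bint; have [z Az] := A0.
have mS : measurable (~` star rad A).
  by apply: measurableC; exact: measurable_star.
have [mb _] := (cL1P _ _).1 b1.
(* The indicator puts the domain into the integrand, so that Tonelli applies on the full product. *)
pose G (p : X * X) := ((\1_(~` star rad A) p.1 : R)%:C *
  ((K p - K (p.1, z)) * b p.2))%R.
have mKz : cmeasurable (fun x : X => K (x, z)).
  apply: (@cmeasurable_comp _ _ _ _ _ (fun x => (x, z))) mK.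
  by apply: measurable_fun_pair => //; exact: measurable_cst.
have mG : cmeasurable G.
  apply: cmeasurableM.
    apply: (@cmeasurable_comp _ _ _ _ _ fst (fun x => (\1_(~` star rad A) x : R)%:C)) => //.
    exact: cmeasurable_indic.
  apply: cmeasurableM; last exact: (@cmeasurable_comp _ _ _ _ _ snd b).
  apply: cmeasurableB => //.
  exact: (@cmeasurable_comp _ _ _ _ _ fst (fun x => K (x, z))).
have mG1 : measurable_fun setT (fun p => (normc (G p))%:E).
  exact: cmeasurable_normcE.
have G0 p : 0 <= (normc (G p))%:E by rewrite lee_fin normc_ge0.
have Gout x y : ~ (~` star rad A) x -> normc (G (x, y)) = 0%R.
  by move=> nx; rewrite /G /= indicE memNset// mul0r normc0.
have Gin x y : (~` star rad A) x ->
    normc (G (x, y)) = normc ((K (x, y) - K (x, z)) * b y)%R.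
  by move=> nx; rewrite /G /= indicE mem_set// mul1r.
apply: (@le_trans _ _ (\int[mu]_(x in ~` star rad A)
    (2%:E * \int[mu]_y (normc (G (x, y)))%:E))).
  apply: ae_ge0_le_integral => //.
  - by move=> x _; rewrite lee_fin normc_ge0.
  - exact: cmeasurable_normcE.
  - by move=> x _; rewrite mule_ge0// integral_ge0.
  - apply: measurable_funeM; apply: (measurable_funS measurableT) => //.
    exact: (measurable_fun_fubini_tonelli_F (fun p => (normc (G p))%:E)).
  apply: filterS (off_star_ae RA Az b1 b2 bA bint) => x Tx nx.
  apply: le_trans (Tx nx) _; rewrite le_eqVlt; apply/orP; left; apply/eqP.
  by congr (_ * _); apply: eq_integral => y _; rewrite Gin.
rewrite ge0_integralZl//; first last.
- by move=> x _; exact: integral_ge0.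
- apply: (measurable_funS measurableT) => //.
  exact: (measurable_fun_fubini_tonelli_F (fun p => (normc (G p))%:E)).
apply: lee_wpmul2l => //.
apply: (@le_trans _ _ (\int[mu]_x \int[mu]_y (normc (G (x, y)))%:E)).
  apply: ge0_subset_integral => //.
  - exact: (measurable_fun_fubini_tonelli_F (fun p => (normc (G p))%:E)).
  - by move=> x _; exact: integral_ge0.
rewrite (fubini_tonelli (fun p => (normc (G p))%:E))//.
rewrite -ge0_integralZl//; first last.
- exact: hormander_ge0 RA A0.
- by move=> x _; rewrite lee_fin normc_ge0.
- exact: cmeasurable_normcE.
apply: ge0_le_integral => //.
- by move=> y _; exact: integral_ge0.
- exact: (measurable_fun_fubini_tonelli_G (fun p => (normc (G p))%:E)).
- by apply: measurable_funeM; exact: cmeasurable_normcE.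
move=> y _; have [Ay|nAy] := pselect (A y); last first.
  rewrite bA// normc0 mule0 integral0_eq// => x _.
  by rewrite /G /= bA// !mulr0 normc0.
rewrite (_ : \int[mu]_x _ = \int[mu]_(x in ~` star rad A)
    ((normc (b y))%:E * (normc (K (x, y) - K (x, z)))%:E)); last first.
  rewrite [RHS]integral_mkcond; apply: eq_integral => x _; rewrite patchE.
  case: ifPn => [/set_mem nx|/negP nx].
    by rewrite Gin// normcM EFinM muleC.
  by rewrite Gout// => h; apply: nx; exact: mem_set.
have mKyz : cmeasurable (fun x => (K (x, y) - K (x, z))%R).
  apply: cmeasurableB => //.
  apply: (@cmeasurable_comp _ _ _ _ _ (fun x => (x, y))) mK.
  by apply: measurable_fun_pair => //; exact: measurable_cst.
rewrite ge0_integralZl//; first last.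
- by rewrite lee_fin normc_ge0.
- by move=> x _; rewrite lee_fin normc_ge0.
- exact: cmeasurable_normcE.
rewrite muleC; apply: lee_wpmul2r; first by rewrite lee_fin normc_ge0.
exact: hormander_le.
Qed.

End OffStar.

(** * Approximation of atoms *)

Section AtomApproximation.
Context {R : realType} {d : measure_display} {X : measurableType d}.
Variable mu : {measure set X -> \bar R}.
Implicit Types f g a : X -> R[i].

Lemma cvge0_lt (u : nat -> \bar R) (e : R) : u @ \oo --> 0 -> (0 < e)%R ->
  exists n, u n < e%:E.
Proof.
move=> u0 e0; have e0' : 0 < e%:E by rewrite lte_fin.
have [N _ NP] := u0 _ (open_ereal_lt' e0').
by exists N; exact: NP (leqnn N).
Qed.

(** Dominated convergence with majorant [|a|]: at each point the integrand is zero as soon as [n]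
    exceeds [|a x|]. *)
Lemma cvg_truncation a (e : R) : cL mu 1 a -> (0 < e)%R ->
  exists n : nat,
    \int[mu]_x (normc ((\1_[set y | (n%:R < normc (a y))%R] x : R)%:C * a x))%:E
      <= e%:E.
Proof.
move=> a1 e0; have [ma a_fin] := (cL1P mu a).1 a1.
pose f_ (n : nat) x : \bar R :=
  (normc ((\1_[set y | (n%:R < normc (a y))%R] x : R)%:C * a x))%R%:E.
have f_E n x : f_ n x = if (n%:R < normc (a x))%R then (normc (a x))%:E else 0.
  rewrite /f_ indicE; case: ifPn => h.
    by rewrite mem_set//= mul1r.
  by rewrite memNset ?mul0r ?normc0//; exact/negP.
have mf n : measurable_fun setT (f_ n).
  apply: cmeasurable_normcE; apply: cmeasurableM => //.
  by apply: cmeasurable_indic; exact: measurable_normc_gt.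
have [] := @dominated_convergence _ _ _ mu setT measurableT f_ (cst 0)
  (fun x => (normc (a x))%:E) mf.
- exact: measurable_cst.
- apply: aeW => x _; apply: cvg_near_cst.
  exists (Num.Def.archi_bound (normc (a x))) => // n /= an.
  rewrite f_E ltNge; case: ifPn => //; rewrite -ltNge => /lt_le_trans h.
  have := h _ (ltW (archi_boundP (normc_ge0 _))).
  by rewrite ltr_nat ltnNge an.
- apply/integrableP; split; first exact: cmeasurable_normcE.
  by under eq_integral do rewrite gee0_abs ?lee_fin ?normc_ge0//.
- apply: aeW => x n _; rewrite f_E; case: ifPn => _.
    by rewrite gee0_abs// lee_fin normc_ge0.
  by rewrite abse0 lee_fin normc_ge0.
move=> _ _; rewrite [X in _ --> X]integral0_eq// => cv.
by have [n /ltW nP] := cvge0_lt cv e0; exists n.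
Qed.

Lemma cL2_bounded f (A : set X) (B : R) : cmeasurable f -> measurable A ->
  mu A < +oo -> (forall x, normc (f x) <= B)%R ->
  (forall x, ~ A x -> f x = 0%R) -> cL mu 2 f.
Proof.
move=> mf mA Afin fB fA; apply/cL2P; split => //.
apply: (@le_lt_trans _ _ ((B ^+ 2)%:E * mu A)); last first.
  by apply: lte_mul_pinfty => //; rewrite lee_fin sqr_ge0.
rewrite -integral_cst// [leRHS]integral_mkcond.
apply: ge0_le_integral => //.
- by move=> x _; rewrite lee_fin sqr_ge0.
- by apply/measurable_EFinP; apply: measurable_funX; exact: cmeasurable_normc.
- by apply/(measurable_restrictT _ mA); exact: measurable_cst.
move=> x _; rewrite patchE; case: ifPn => [_|/negP xA].
  rewrite lee_fin lerXn2r// ?nnegrE ?normc_ge0//.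
  exact: le_trans (normc_ge0 _) (fB x).
by rewrite fA ?normc0 ?expr0n// => Ax; apply: xA; exact: mem_set.
Qed.

Lemma cint_indic (A : set X) (m : R) : measurable A -> mu A = m%:E ->
  cint mu setT (fun x => (\1_A x : R)%:C) = m%:C.
Proof.
move=> mA Am; rewrite /cint /= Rintegral_cst// mul0r; congr (_ +i* _).
by rewrite /Rintegral integral_indic// setIT Am.
Qed.

Lemma cL1_indic (A : set X) : measurable A -> mu A < +oo ->
  cL mu 1 (fun x => (\1_A x : R)%:C).
Proof.
move=> mA Afin; apply/cL1P; split; first exact: cmeasurable_indic.
under eq_integral do rewrite normc_real ger0_norm//.
by rewrite integral_indic// setIT.
Qed.

(* Truncate [a] at a large height and subtract the mean value over [A]. *)
Lemma cL2_mean_zero_approx (A : set X) (m : R) a (e : R) : measurable A ->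
  mu A = m%:E -> (0 < m)%R -> cL mu 1 a -> (forall x, ~ A x -> a x = 0%R) ->
  cint mu setT a = 0%R -> (0 < e)%R ->
  exists b, [/\ cL mu 1 b /\ cL mu 2 b, (forall x, ~ A x -> b x = 0%R),
    cint mu setT b = 0%R, \int[mu]_x (normc (a x - b x))%:E <= e%:E &
    \int[mu]_x (normc (b x))%:E <= 4%:E * \int[mu]_x (normc (a x))%:E].
Proof.
move=> mA Am m0 a1 aA aint e0.
have Afin : mu A < +oo by rewrite Am ltry.
have [ma a_fin] := (cL1P mu a).1 a1.
(* The error is three times the integral of the removed part: once for that part and twice for the
   correction of the mean. *)
have e30 : (0 < e / 3)%R by rewrite divr_gt0.
have [n nP] := cvg_truncation a1 e30.
pose S := [set y | (n%:R < normc (a y))%R].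
pose c x := ((\1_S x : R)%:C * a x)%R.
have cE x : c x = if (n%:R < normc (a x))%R then a x else 0%R.
  rewrite /c indicE; case: ifPn => h.
    by rewrite mem_set//= mul1r.
  by rewrite memNset ?mul0r//; exact/negP.
have ca x : (normc (c x) <= normc (a x))%R.
  by rewrite cE; case: ifPn => // _; rewrite normc0 normc_ge0.
have mc : cmeasurable c.
  by apply: cmeasurableM => //; apply: cmeasurable_indic; exact: measurable_normc_gt.
have c1 : cL mu 1 c by exact: cL1_le a1 _.
(* [w] is the mean over [A] of the removed part [c]. Spreading it over [A] as [D] restores the
   integral that the truncation [a - c] lost. *)
pose w := (cint mu setT c / m%:C)%R.
pose D x := (w * (\1_A x : R)%:C)%R.
have D1 : cL mu 1 D by apply: cL1Z; exact: cL1_indic.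
have mD : cmeasurable D by have [] := (cL1P _ _).1 D1.
pose b x := ((a x - c x) + D x)%R.
have cm0 : m%:C != 0%R :> R[i].
  by apply/eqP => -[mE]; move: m0; rewrite mE ltxx.
have wm : (normc w * m = normc (cint mu setT c))%R.
  by rewrite -[in LHS](ger0_norm (ltW m0)) -normc_real -normcM /w divfK.
have ID : \int[mu]_x (normc (D x))%:E <= 2%:E * \int[mu]_x (normc (c x))%:E.
  rewrite integral_normcZ//; last exact: cmeasurable_indic.
  under eq_integral do rewrite normc_real ger0_norm//.
  rewrite integral_indic// setIT Am -EFinM wm.
  exact: normc_cint_le.
have ab x : normc (a x - b x)%R = normc (c x - D x)%R.
  by congr normc; rewrite /b; ring.
have Iab : \int[mu]_x (normc (a x - b x))%:E <=
    3%:E * \int[mu]_x (normc (c x))%:E.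
  under eq_integral do rewrite ab.
  rewrite (_ : 3%:E = 1%:E + 2%:E); last by rewrite -EFinD; congr EFin; ring.
  rewrite ge0_muleDl// mul1e.
  apply: (@le_trans _ _ (\int[mu]_x (normc (c x))%:E + \int[mu]_x (normc (D x))%:E)).
    exact: integral_normcB.
  by rewrite leeD2l.
have b1 : cL mu 1 b by apply: cL1D => //; exact: cL1B.
have mb : cmeasurable b by have [] := (cL1P _ _).1 b1.
have bA x : ~ A x -> b x = 0%R.
  move=> nA; rewrite /b /D cE aA// normc0 ltNge ler0n /= subrr add0r.
  by rewrite indicE memNset// mulr0.
exists b; split => //.
(* The truncation is bounded by [n], the correction by [|w|], and both live on a set of finite
   measure. *)
- split => //; apply: (@cL2_bounded _ A (n%:R + normc w)) => // x.
  apply: le_trans (normcD _ _) _; apply: lerD.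
    rewrite cE; case: ltP => h; first by rewrite subrr normc0.
    by rewrite subr0.
  rewrite /D normcM normc_real ger0_norm// indicE.
  by case: (_ \in _); rewrite ?mulr1// mulr0 normc_ge0.
- rewrite (_ : b = fun x => a x - (c x - D x))%R; last first.
    by apply/funext => x; rewrite /b; ring.
  rewrite cintB//; last exact: cL1B.
  rewrite cintB// aint cintZ; last exact: cL1_indic.
  by rewrite (cint_indic mA Am) /w divfK// subrr subrr.
- apply: (le_trans Iab); rewrite -lee_pdivlMl// -EFinM mulrC.
  exact: nP.
- have Ica : \int[mu]_x (normc (c x))%:E <= \int[mu]_x (normc (a x))%:E.
    apply: ge0_le_integral => //.
    + by move=> x _; rewrite lee_fin normc_ge0.
    + exact: cmeasurable_normcE.
    + exact: cmeasurable_normcE.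
    + by move=> x _; rewrite lee_fin.
  rewrite (_ : 4%:E = 1%:E + 3%:E); last by rewrite -EFinD; congr EFin; ring.
  rewrite ge0_muleDl// mul1e.
  apply: (@le_trans _ _ (\int[mu]_x (normc (a x))%:E +
                         \int[mu]_x (normc (a x - b x))%:E)); last first.
    by rewrite leeD2l//; apply: (le_trans Iab); exact: lee_wpmul2l.
  have -> : \int[mu]_x (normc (b x))%:E =
            \int[mu]_x (normc (a x - (a x - b x)))%:E.
    by apply: eq_integral => x _; rewrite subKr.
  by apply: integral_normcB => //; exact: cmeasurableB.
Qed.

(** Splitting at height [1 / m] replaces Hölder's inequality: the values below it contribute at most
    1 over [A], and those above at most 1 by [le_powR_of_lt] and the size condition. *)
Lemma atom_L1_le q m (A : set X) a : (1 < q)%R -> measurable A ->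
  mu A = m%:E -> (0 < m)%R -> cmeasurable a -> (forall x, ~ A x -> a x = 0%R) ->
  \int[mu]_x (normc (a x) `^ q)%:E <= (m `^ (1 - q))%:E ->
  \int[mu]_x (normc (a x))%:E <= 2%:E.
Proof.
move=> q1 mA Am m0 ma aA aq; have mi0 : (0 < m^-1)%R by rewrite invr_gt0.
have mm := powRVM (1 - q)%R m0.
apply: (@le_trans _ _ (\int[mu]_x ((m^-1)%:E * (\1_A x)%:E +
    (m^-1 `^ (1 - q))%:E * (normc (a x) `^ q)%:E))).
  apply: ge0_le_integral => //.
  - by move=> x _; rewrite lee_fin normc_ge0.
  - exact: cmeasurable_normcE.
  - apply: emeasurable_funD; apply: measurable_funeM.
      by apply/measurable_EFinP; exact: measurable_indic.
    exact: measurable_normc_powR.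
  move=> x _; rewrite -!EFinM -EFinD lee_fin indicE.
  have [Ax|nAx] := pselect (A x); last first.
    by rewrite aA// normc0 addr_ge0 ?mulr_ge0 ?powR_ge0// ltW.
  rewrite mem_set//= mulr1.
  have [h|h] := leP (normc (a x)) (m^-1)%R.
    by apply: le_trans h _; rewrite lerDl mulr_ge0 ?powR_ge0.
  apply: le_trans (le_powR_of_lt (ltW q1) mi0 h) _.
  by rewrite lerDr ltW.
rewrite ge0_integralD//; first last.
- by apply: measurable_funeM; exact: measurable_normc_powR.
- by move=> x _; rewrite mule_ge0 ?lee_fin ?powR_ge0.
- by apply: measurable_funeM; apply/measurable_EFinP; exact: measurable_indic.
- by move=> x _; rewrite mule_ge0 ?lee_fin ?(ltW mi0).
rewrite (_ : 2%:E = 1%:E + 1%:E); last by rewrite -EFinD.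
apply: leeD.
  rewrite ge0_integralZl//; first last.
  - by rewrite lee_fin ltW.
  - by apply/measurable_EFinP; exact: measurable_indic.
  by rewrite integral_indic// setIT Am -EFinM mulVf// gt_eqF.
rewrite ge0_integralZl//; first last.
- by rewrite lee_fin powR_ge0.
- by move=> x _; rewrite lee_fin powR_ge0.
- exact: measurable_normc_powR.
apply: (@le_trans _ _ ((m^-1 `^ (1 - q))%:E * (m `^ (1 - q))%:E)).
  by apply: lee_wpmul2l => //; rewrite lee_fin powR_ge0.
by rewrite -EFinM mm.
Qed.

(** The size condition of an atom without average and root: raise to the power [q] and multiply by
    [m], as [m m ^ (- q) = m ^ (1 - q)]. *)
Lemma atom_powR_le q m (I : \bar R) : (0 < q)%R -> (0 < m)%R -> 0 <= I ->
  ((m%:E)^-1 * I) `^ q^-1 <= (m%:E)^-1 -> I <= (m `^ (1 - q))%:E.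
Proof.
move=> q0 m0 I0; rewrite inver gt_eqF// => h.
have mi0 : (0 < m^-1)%R by rewrite invr_gt0.
have mI0 : 0 <= (m^-1)%:E * I by rewrite mule_ge0// lee_fin ltW.
have : (((m^-1)%:E * I) `^ q^-1) `^ q <= (m^-1)%:E `^ q.
  apply: gt0_ler_poweR => //; first exact: ltW.
  - by rewrite in_itv /= leey andbT poweR_ge0.
  - by rewrite in_itv /= leey andbT lee_fin ltW.
rewrite -poweRrM mulVf ?gt_eqF// poweRe1// poweR_EFin.
rewrite -lee_pdivlMl ?invrK// => /le_trans; apply.
rewrite -EFinM lee_fin powRD ?(gt_eqF m0) ?implybT// powRr1 ?(ltW m0)//.
by rewrite -[in leLHS](powR_inv1 (ltW m0)) -powRrM mulN1r.
Qed.

End AtomApproximation.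

(** * The bound on atoms *)

Section AtomBound.
Context (R : realType) (d : measure_display) (X : metricMeasurableType R d).
Variable mu : {sigma_finite_measure set X -> \bar R}.
Variables (calR : set (set X)) (kappa0 : R) (rad : set X -> R).
Variables (T T1 : (X -> R[i]) -> (X -> R[i])) (K : X * X -> R[i]).
Hypothesis bX : borel_compatible X.
Hypothesis CZ : CZ_space mu calR kappa0 rad.
Hypothesis T2 : L2_bounded_operator mu T.
Hypothesis mK : cmeasurable K.
Hypothesis TK : kernel_off_diagonal mu T K.
Hypothesis HK : hormander_sup mu calR rad K < +oo.
Hypothesis T1T : L1_extension mu T T1.

(** The L^2 approximants [b] of mean zero obey a bound independent of the error [e], so it survives
    the limit. The constant is [2 * H * 4], with 4 from the L^1 norm of [b]. *)
Lemma off_star_atom_le (H m : R) A a : hormander_sup mu calR rad K <= H%:E ->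
  calR A -> mu A = m%:E -> (0 < m)%R -> cL mu 1 a ->
  (forall x, ~ A x -> a x = 0%R) -> cint mu setT a = 0%R ->
  \int[mu]_(x in ~` star rad A) (normc (T1 a x))%:E <=
    (8 * H)%:E * \int[mu]_x (normc (a x))%:E.
Proof.
move=> KH RA Am m0 a1 aA aint.
have mA : measurable A by have [_ + _ _] := CZ; apply.
(* Positive measure yields the reference point of the Hormander condition. *)
have A0 : A !=set0.
  apply/set0P/eqP => A0; move: m0; have := Am; rewrite A0 measure0 => -[<-].
  by rewrite ltxx.
have H0 : 0 <= H%:E by apply: le_trans KH; exact: hormander_ge0 RA A0.
have mS : measurable (~` star rad A).
  by apply: measurableC; exact: measurable_star.
apply: (L1_ext_integral_le_approx T1T) => // e e0.
have [b [[b1 b2] bA bint abe b4]] :=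
  cL2_mean_zero_approx mA Am m0 a1 aA aint e0.
exists b; split => //.
have [_ T1b _] := T1T; have [_ [C /(_ b b2)[[mTb _] _]]] := T2.
rewrite (@ae_eq_integral _ _ _ mu _ (fun x => (normc (T b x))%:E))//; first last.
- by apply: filterS (T1b b b1 b2) => x -> _.
- exact: cmeasurable_normcE.
- by apply: cmeasurable_normcE; exact: (L1_ext_measurable T1T).
apply: le_trans (off_star_le bX CZ mK TK RA A0 b1 b2 mTb bA bint) _.
apply: (@le_trans _ _ (2%:E * (H%:E * (4%:E * \int[mu]_x (normc (a x))%:E)))).
  apply: lee_wpmul2l => //; apply: lee_pmul => //.
  - exact: hormander_ge0 RA A0.
  - exact: normc_integral_ge0.
rewrite !muleA -!EFinM (_ : 2 * H * 4 = 8 * H)%R//.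
by ring.
Qed.

(** Start the dyadic summation at height [s = 1 / m]. The low part is at most
    [mu (star rad A) / m <= kappa0]; in the high part the power of [1 / m] cancels the factor
    [m ^ (1 - q)] of the size condition. *)
Lemma star_atom_le q : (1 < q)%R -> (q <= 2)%R ->
  exists2 C : R, (0 <= C)%R & forall A m a,
  calR A -> mu A = m%:E -> (0 < m)%R -> cL mu 1 a ->
  \int[mu]_x (normc (a x) `^ q)%:E <= (m `^ (1 - q))%:E ->
  \int[mu]_(x in star rad A) (normc (T1 a x))%:E <= C%:E.
Proof.
move=> q1 q2.
have [C C0 wC] := L1_ext_weakqq T1T T2 (ltW q1) q2.
have [k0 _ starP _] := CZ.
have r1 := powR2_lt1 q1.
exists (kappa0 + 2 / (1 - 2 `^ (1 - q)) * C)%R.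
  rewrite addr_ge0// ?(ltW k0)// mulr_ge0// divr_ge0// subr_ge0 ltW//.
move=> A m a RA Am m0 a1 aq.
have mm := powRVM (1 - q)%R m0.
have mi0 : (0 < m^-1)%R by rewrite invr_gt0.
apply: le_trans (weak_type_integral_le
   (J := C%:E * \int[mu]_x (normc (a x) `^ q)%:E) _ _ mi0 q1 _ _) _.
- exact: (L1_ext_measurable T1T).
- exact: measurable_star.
- by rewrite mule_ge0 ?lee_fin//; exact: powR_integral_ge0.
- by move=> t t0; rewrite muleA -EFinM [(_ * C)%R]mulrC; exact: wC.
rewrite EFinD; apply: leeD.
  have [_ _] := starP _ RA; rewrite Am => /(@lee_wpmul2l _ (m^-1)%:E) h.
  apply: le_trans (h _) _; first by rewrite lee_fin ltW.
  by rewrite -!EFinM lee_fin mulrCA mulVf ?gt_eqF// mulr1.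
have cc0 : (0 <= 2 * m^-1 `^ (1 - q) / (1 - 2 `^ (1 - q)))%R.
  by rewrite divr_ge0 ?mulr_ge0 ?powR_ge0// subr_ge0 ltW.
apply: (@le_trans _ _ ((2 * m^-1 `^ (1 - q) / (1 - 2 `^ (1 - q)))%:E *
   (C%:E * (m `^ (1 - q))%:E))).
  by apply: lee_wpmul2l; [rewrite lee_fin|apply: lee_wpmul2l].
rewrite -!EFinM lee_fin le_eqVlt; apply/orP; left; apply/eqP.
transitivity (2 / (1 - 2 `^ (1 - q)) * C * (m^-1 `^ (1 - q) * m `^ (1 - q)))%R.
  by ring.
by rewrite mm mulr1.
Qed.

Lemma atom_bound q : (1 < q)%R -> (q <= 2)%R ->
  exists2 C : R, (0 < C)%R & forall a, is_atom mu calR q a ->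
    \int[mu]_x (normc (T1 a x))%:E <= C%:E.
Proof.
move=> q1 q2; have q0 : (0 < q)%R by exact: lt_trans q1.
have [C C0 CP] := star_atom_le q1 q2.
(* The supremum is [-oo] when no member of [calR] has a point, hence a nonnegative majorant. *)
have [H H0 KH] : exists2 H : R, (0 <= H)%R & hormander_sup mu calR rad K <= H%:E.
  case: (hormander_sup mu calR rad K) HK => [h _|//|_]; last by exists 0%R; rewrite ?leNye.
  by exists `|h|%R => //; rewrite lee_fin ler_norm.
(* [C] comes from the enlarged set and [8 * H] times the L^1 bound 2 from its complement; the added
   1 makes the constant positive, for a later division. *)
exists (C + 16 * H + 1)%R; first by rewrite ltr_wpDl// addr_ge0// mulr_ge0.
move=> a [A [[RA Afin] a1 aA aq aint]].
have mA : measurable A by have [_ + _ _] := CZ; apply.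
have [ma a_fin] := (cL1P mu a).1 a1.
have : mu A \is a fin_num by rewrite ge0_fin_numE.
move: aq Afin; case Am : (mu A) => [m| |]// aq _ _.
have m0 : (0 <= m)%R by rewrite -lee_fin -Am.
have Cp : (0 <= C + 16 * H + 1)%R by rewrite !addr_ge0// mulr_ge0.
(* On a null set the atom is zero almost everywhere, and the bound for the zero function
   transfers. *)
move: m0; rewrite le_eqVlt => /orP[/eqP m0|m0].
  apply: (L1_ext_integral_le_ae T1T (g := fun=> 0%R)) => //; first exact: cL1_0.
    have : mu.-negligible A by apply/(negligibleP _ mA); apply: (etrans Am); rewrite -m0.
    move=> /(negligibleU aA); apply: negligibleS => x /= ax.
    have [Ax|nAx] := pselect (A x); [by right|left => h; apply: ax; exact: h].
  by rewrite (L1_ext0 T1T) lee_fin.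
(* An atom vanishes off [A] only almost everywhere; this version vanishes there everywhere, as the
   preceding lemmas require. *)
pose a' x := ((\1_A x : R)%:C * a x)%R.
have a'E x : a' x = if x \in A then a x else 0%R.
  by rewrite /a' indicE; case: (x \in A); rewrite ?mul1r ?mul0r.
have ma' : cmeasurable a' by apply: cmeasurableM => //; exact: cmeasurable_indic.
have a'1 : cL mu 1 a'.
  apply: cL1_le a1 _ => // x; rewrite a'E; case: ifPn => // _.
  by rewrite normc0 normc_ge0.
have aa' : {ae mu, forall x, a x = a' x}.
  move: aA; rewrite /supported_in; apply: filterS => x ax; rewrite a'E; case: ifPn => // /negP xA.
  by apply: ax => Ax; apply: xA; exact: mem_set.
apply: (L1_ext_integral_le_ae T1T (g := a')) => //.
have a'A x : ~ A x -> a' x = 0%R by move=> nA; rewrite a'E memNset.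
have a'int : cint mu setT a' = 0%R.
  have : cint mu setT (fun x => (a x - a' x)%R) = 0%R.
    apply: eq0_normc; apply/eqP; rewrite eq_le normc_ge0 andbT -lee_fin.
    apply: le_trans (normc_cint_le (cL1B a1 a'1)) _.
    by rewrite integral_normcB_eq0// mule0.
  by rewrite cintB// aint sub0r => /eqP; rewrite oppr_eq0 => /eqP.
have a'q : \int[mu]_x (normc (a' x) `^ q)%:E <= (m `^ (1 - q))%:E.
  rewrite (_ : \int[mu]_x _ = \int[mu]_(x in A) (normc (a x) `^ q)%:E).
    by apply: atom_powR_le => //; exact: powR_integral_ge0.
  rewrite [RHS]integral_mkcond; apply: eq_integral => x _.
  rewrite patchE a'E; case: ifPn => // _.
  by rewrite normc0 powR0// gt_eqF.
have mS : measurable (star rad A) by exact: measurable_star.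
have mT := L1_ext_measurable T1T a'1.
rewrite -(setUv (star rad A)) ge0_integral_setU//; first last.
- exact/disj_setPCl.
- by move=> x _; rewrite lee_fin normc_ge0.
- exact: cmeasurable_normcE.
- exact: measurableC.
apply: (@le_trans _ _ (C%:E + (8 * H)%:E * 2%:E)).
  apply: leeD; first exact: CP a'q.
  apply: le_trans (off_star_atom_le KH RA Am m0 a'1 a'A a'int) _.
  apply: lee_wpmul2l; first by rewrite lee_fin mulr_ge0.
  exact: (atom_L1_le q1 mA Am m0 ma' a'A a'q).
by rewrite -EFinM -EFinD lee_fin; lra.
Qed.

End AtomBound.

(** * Atomic sums *)

Section AtomicSums.
Context {R : realType} {d : measure_display} {X : measurableType d}.
Variable mu : {measure set X -> \bar R}.
Variables T T1 : (X -> R[i]) -> (X -> R[i]).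
Hypothesis T1T : L1_extension mu T T1.

Lemma L1_ext_partial_sum_le (C : R) (lambda : nat -> R[i])
    (a : nat -> X -> R[i]) n : (0 <= C)%R ->
  (forall j, cL mu 1 (a j)) ->
  (forall j, \int[mu]_x (normc (T1 (a j) x))%:E <= C%:E) ->
  cL mu 1 (fun x => (\sum_(i < n) lambda i * a i x)%R) /\
  \int[mu]_x (normc (T1 (fun x => (\sum_(i < n) lambda i * a i x)%R) x))%:E <=
  C%:E * \sum_(0 <= i < n) (normc (lambda i))%:E.
Proof.
move=> C0 a1 aC; elim: n => [|n [S1 SC]].
  rewrite (_ : (fun x => _) = (fun=> 0%R)); last first.
    by apply/funext => x; rewrite big_ord0.
  by split; [exact: cL1_0|rewrite (L1_ext0 T1T) big_geq// mule0].
rewrite (_ : (fun x => (\sum_(i < n.+1) _)%R) =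
  (fun x => lambda n * a n x + \sum_(i < n) lambda i * a i x)%R); last first.
  by apply/funext => x; rewrite big_ord_recr /= addrC.
have la1 : cL mu 1 (fun x => (lambda n * a n x)%R) by exact: cL1Z.
split; first exact: cL1D.
have mTa := L1_ext_measurable T1T (a1 n).
have mTS := L1_ext_measurable T1T S1.
have mlTa : cmeasurable (fun x => (lambda n * T1 (a n) x)%R).
  by apply: cmeasurableM => //; exact: cmeasurable_cst.
rewrite (@ae_eq_integral _ _ _ mu _ (fun x => (normc (lambda n * T1 (a n) x +
    T1 (fun x => (\sum_(i < n) lambda i * a i x)%R) x))%:E))//; first last.
- by apply: filterS (L1_extZD T1T (lambda n) (a1 n) S1) => x -> _.
- by apply: cmeasurable_normcE; exact: cmeasurableD.
- by apply: cmeasurable_normcE; apply: (L1_ext_measurable T1T); exact: cL1D.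
apply: le_trans (integral_normcD _ _ mlTa mTS) _ => //.
rewrite big_nat_recr//= ge0_muleDr ?lee_fin ?normc_ge0//; last first.
  by apply: sume_ge0 => i _; rewrite lee_fin normc_ge0.
rewrite addeC; apply: leeD => //.
rewrite integral_normcZ// muleC; apply: lee_wpmul2r => //.
by rewrite lee_fin normc_ge0.
Qed.

(** [T1] is only ever applied to finite sums: these approximate [f] in L^1 and share the bound by
    the full series. *)
Lemma L1_ext_sum_le (C : R) f (lambda : nat -> R[i]) (a : nat -> X -> R[i]) :
  (0 <= C)%R -> cL mu 1 f ->
  (forall j, cL mu 1 (a j)) ->
  (forall j, \int[mu]_x (normc (T1 (a j) x))%:E <= C%:E) ->
  L1_sum mu (fun j x => (lambda j * a j x)%R) f ->
  \int[mu]_x (normc (T1 f x))%:E <=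
  C%:E * \sum_(0 <= j <oo) (normc (lambda j))%:E.
Proof.
move=> C0 f1 a1 aC cv; apply: (L1_ext_integral_le_approx T1T) => // e e0.
have [n] := cvge0_lt cv e0; rewrite cLnorm1E => /ltW nP.
have [S1 SC] := L1_ext_partial_sum_le lambda n C0 a1 aC.
exists (fun x => (\sum_(i < n) lambda i * a i x)%R); split => //.
apply: (le_trans SC); apply: lee_wpmul2l => //.
by apply: nneseries_lim_ge => j _ _; rewrite lee_fin normc_ge0.
Qed.

End AtomicSums.

(** * From atomic decompositions to the Hardy space norm *)

Theorem theorem3p10 (R : realType) (d : measure_display)
    (X : metricMeasurableType R d) (mu : {sigma_finite_measure set X -> \bar R})
    (calR : set (set X)) (kappa0 : R) (rad : set X -> R)
    (T T1 : (X -> R[i]) -> (X -> R[i])) (K : X * X -> R[i]) :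
  borel_compatible X ->
  CZ_space mu calR kappa0 rad ->
  condition_C calR ->
  L2_bounded_operator mu T ->
  locally_integrable_off_diagonal mu K ->
  kernel_off_diagonal mu T K ->
  hormander_sup mu calR rad K < +oo ->
  L1_extension mu T T1 ->
  forall q : R, (1 < q)%R -> (q <= 2)%R ->
    exists C : R, forall f : X -> R[i], H1 mu calR q f ->
      cL mu 1 (T1 f) /\ cLnorm mu 1 (T1 f) <= C%:E * H1norm mu calR q f.
Proof.
move=> bX CZ _ T2 [mK _] TK HK T1T q q1 q2.
have [C C0 CP] := atom_bound bX CZ T2 mK TK HK T1T q1 q2.
exists C => f [f1 [lambda0 [a0 dec0]]].
(* One decomposition gives membership in L^1; the norm bound needs all of them with the same [C]. *)
have key lambda a : atomic_decomposition mu calR q f lambda a ->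
    cLnorm mu 1 (T1 f) <= C%:E * \sum_(0 <= j <oo) (normc (lambda j))%:E.
  move=> [aA _ fsum]; rewrite cLnorm1E.
  apply: (L1_ext_sum_le T1T (a := a)) => //; first exact: ltW.
    by move=> j; have [A []] := aA j.
  by move=> j; exact: CP.
split.
  split; first exact: (L1_ext_measurable T1T).
  apply: (le_lt_trans (key _ _ dec0)); have [_ lfin _] := dec0.
  by apply: lte_mul_pinfty => //; rewrite lee_fin ltW.
(* Dividing by [C > 0] isolates the infimum, which is then bounded below term by term. *)
rewrite -[C in leRHS]invrK -lee_pdivrMl ?invr_gt0//.
rewrite invrK; apply: le_ereal_inf_tmp => _ [lambda [a dec] <-].
by rewrite lee_pdivrMl//; exact: key dec.
Qed.
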